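(* Let $\varphi$ be a crystalline anisotropy on $\mathbb{R}^2$, let $\alpha>0$, and let $\Gamma^0$ be a closed convex admissible polygonal curve (oriented clockwise). Let $\{\Gamma(t)\}_{t\in[0,T^\dagger)}$ be the unique (maximal) crystalline elastic flow starting from $\Gamma^0$. Then $T^\dagger=+\infty$ and there exists $p\in\mathbb{R}^2$ such that $\Gamma(t)$ Kuratowski converges, as $t\to+\infty$, to $\partial W^\varphi_{\sqrt\alpha}(p)$, where $W^\varphi_{\sqrt\alpha}(p)=\{x:\varphi(x-p)\le\sqrt\alpha\}$ is the Wulff shape of radius $\sqrt\alpha$ centered at $p$.
   Context: Anisotropy. An anisotropy is a convex, positively one-homogeneous function $\varphi:\mathbb{R}^2\to[0,\infty)$ with $c|x|\le\varphi(x)\le C|x|$ for some $0<c\le C<\infty$; $W^\varphi=\{\varphi\le1\}$ and $\varphi^o(x)=\max_{y\in W^\varphi}\langle x,y\rangle$. It is crystalline if $W^\varphi$ is a polygon, whose edges are called facets; $\nu_F$ is the outward unit normal of the facet $F$. $\mathcal{H}^1$ is length. Polygonal curves. All curves are oriented and may self-intersect. A closed polygonal curve is a closed consecutive union $\Gamma=\bigcup_{i=1}^nS_i$ of finitely many segments of positive length, indices being cyclic ($S_0=S_n$, $S_{n+1}=S_1$, likewise for all indexed quantities); consecutive segments are not parallel. $\nu_{S_i}$ is the unit tangent (in the direction of the parametrization) rotated counterclockwise by $90^\circ$. The angle $\theta_i$ between $S_{i-1}$ and $S_i$ is taken in $(0,\pi)$ if $S_{i-1},S_i$ form a convex cone for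 which $\nu_{S_{i-1}},\nu_{S_i}$ are inner normals, and in $(\pi,2\pi)$ otherwise (for a convex polygon with outward normals, $\theta_i$ is $2\pi$ minus the interior angle). Admissibility. $\Gamma$ is admissible if each $\nu_{S_i}$ equals $\nu_{F_i}$ for a (unique) facet $F_i$ of $W^\varphi$, and for consecutive $S_{i-1},S_i$ the facets $F_{i-1},F_i$ have a common vertex. The transition number $c_i$ of $S_i$ is $+1$ if $\theta_i,\theta_{i+1}\in(\pi,2\pi)$, $-1$ if $\theta_i,\theta_{i+1}\in(0,\pi)$, and $0$ otherwise. An admissible polygonal curve is convex if $c_i\ne0$ for every segment. Closed curves are oriented clockwise (so that embedded ones have outward normals); hence a closed convex curve has $c_i=+1$ for all $i$. Parallel curves. $\bar\Gamma=\bigcup_{i=1}^n\bar S_i$ is parallel to $\Gamma=\bigcup_{i=1}^nS_i$ if each $\bar S_i$ is a nondegenerate segment parallel to $S_i$ with $\nu_{\bar S_i}=\nu_{S_i}$. For parallel segments $S,T$ on lines $\ell_S,\ell_T$, $H(S,T)$ is the vector orthogonal to them with $\ell_T=\ell_S+H(S,T)$. Flow. Set $\delta_j=\mathcal{H}^1(F_j)^2\varphi^o(\nu_{S_j})$. A family $\{\Gamma(t)\}_{t\in[0,T)}$, $T\in(0,+\infty]$, is a crystalline elastic flow starting from $\Gamma^0=\bigcup_{i=1}^nS_i^0$ if $\Gamma(t)=\bigcup_{i=1}^nS_i(t)$ is parallel to $\Gamma^0$ for all $t$, and $h_i(t)=\langle H(S_i^0,S_i(t)),\nu_{S_i^0}\rangle$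 belong to $C^0([0,T))\cap C^1(0,T)$, $h_i(0)=0$, and for each $i$ $$\frac{h_i'}{\varphi^o(\nu_{S_i})}=-\frac{c_i\mathcal{H}^1(F_i)}{\mathcal{H}^1(S_i)}-\frac{\alpha}{\mathcal{H}^1(S_i)}\Big(\frac{c_{i-1}^2\delta_{i-1}}{\mathcal{H}^1(S_{i-1})^2\sin\theta_i}+\frac{c_i^2\delta_i[\cot\theta_i+\cot\theta_{i+1}]}{\mathcal{H}^1(S_i)^2}+\frac{c_{i+1}^2\delta_{i+1}}{\mathcal{H}^1(S_{i+1})^2\sin\theta_{i+1}}\Big)$$ in $(0,T)$, where $S_j=S_j(t)$. $T^\dagger$ is the maximal existence time. Kuratowski convergence is that of closed subsets of $\mathbb{R}^2$ (the curve may wind several times around). *)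

(* Defs.v *)
From HB Require Import structures.
From mathcomp Require Import all_boot all_order all_algebra.
From mathcomp Require Import all_classical all_reals all_analysis.

Set Implicit Arguments.
Unset Strict Implicit.
Unset Printing Implicit Defensive.

Import Order.TTheory GRing.Theory Num.Theory.
Import numFieldNormedType.Exports.

Local Open Scope classical_set_scope.
Local Open Scope ring_scope.

Notation plane R := 'rV[R]_2.

Section EuclideanPlane.
Variable R : realType.
Implicit Types (u v : plane R).

Definition dot u v : R := \sum_(j < 2) u 0 j * v 0 j.

(* The norm `|_| that the library puts on matrices is the sup norm, so the
   Euclidean length is defined separately; both induce the same topology. *)
Definition enorm u : R := Num.sqrt (dot u u).

(* counterclockwise rotation by 90 degrees *)
Definition rot90 u : plane R :=
  \row_(j < 2) (if j == 0 then - u 0 1 else u 0 0).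

Definition boundary (A : set (plane R)) : set (plane R) :=
  closure A `\` A°.

End EuclideanPlane.

Notation oseg R := (plane R * plane R)%type.

Section OrientedSegments.
Variable R : realType.
Implicit Types (S T : oseg R).

Definition segment S : set (plane R) :=
  [set (1 - s) *: S.1 + s *: S.2 | s in `[0, 1]].

Definition len S : R := enorm (S.2 - S.1).

Definition tangent S : plane R := (len S)^-1 *: (S.2 - S.1).

Definition normal S : plane R := rot90 (tangent S).

Definition parallel S T : Prop := dot (rot90 (S.2 - S.1)) (T.2 - T.1) = 0.

(* For parallel S and T, this is the vector H orthogonal to both of them such
   that the line through T is the line through S translated by H. *)
Definition offset S T : plane R := dot (T.1 - S.1) (normal S) *: normal S.

End OrientedSegments.

Section Anisotropy.
Variable R : realType.
Implicit Types (phi : plane R -> R).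

Definition anisotropy phi : Prop :=
  [/\ convex_function [set: plane R] phi,
      forall (l : R) x, 0 < l -> phi (l *: x) = l * phi x,
      forall x, 0 <= phi x &
      exists c C : R, 0 < c /\ forall x, c * enorm x <= phi x <= C * enorm x].

Definition wulff phi (r : R) (p : plane R) : set (plane R) :=
  [set x | phi (x - p) <= r].

Definition unit_wulff phi : set (plane R) := [set x | phi x <= 1].

Definition dual phi (x : plane R) : R := sup [set dot x y | y in unit_wulff phi].

Definition convex_polygon (W : set (plane R)) : Prop :=
  exists (m : nat) (p : 'I_m -> plane R),
    W = [set x | exists a : 'I_m -> R,
           [/\ forall k, 0 <= a k, \sum_k a k = 1 & x = \sum_k a k *: p k]].

(* The upper bound phi <= C |.| makes the unit ball a neighbourhood of 0, hence
   the polygon is nondegenerate. *)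
Definition crystalline phi : Prop := convex_polygon (unit_wulff phi).

(* A facet of W is given with its endpoints, in the order for which its left
   normal is the outward unit normal of W along it. *)
Definition is_facet (W : set (plane R)) (F : oseg R) : Prop :=
  [/\ F.1 != F.2,
      forall x, W x -> dot x (normal F) <= dot F.1 (normal F) &
      W `&` [set x | dot x (normal F) = dot F.1 (normal F)] = segment F].

Definition common_vertex (F G : oseg R) : Prop :=
  [\/ F.1 = G.1, F.1 = G.2, F.2 = G.1 | F.2 = G.2].

End Anisotropy.

(* A closed polygonal curve with n segments is the cyclic family v of its
   vertices: S_i goes from v_i to v_(i+1), so v_i is the common endpoint of
   S_(i-1) and S_i. *)
Section PolygonalCurves.
Variables (R : realType) (n : nat).
Implicit Types (v w : 'I_n -> plane R) (i : 'I_n).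

Definition side v i : oseg R := (v i, v (ordS i)).

Definition trace v : set (plane R) := \bigcup_i segment (side v i).

Definition closed_polygonal v : Prop :=
  [/\ (0 < n)%N,
      forall i, 0 < len (side v i) &
      forall i, ~ parallel (side v (ord_pred i)) (side v i)].

(* The cone with apex v_i is spanned by the directions - tangent S_(i-1) and
   tangent S_i. *)
Definition inner_normals v i : bool :=
  (0 <= dot (tangent (side v i)) (normal (side v (ord_pred i)))) &&
  (0 <= dot (- tangent (side v (ord_pred i))) (normal (side v i))).

Definition cone_angle v i : R :=
  acos (dot (- tangent (side v (ord_pred i))) (tangent (side v i))).

Definition theta v i : R :=
  if inner_normals v i then cone_angle v i else 2 * pi - cone_angle v i.

Definition transition v i : R :=
  if (pi < theta v i < 2 * pi) && (pi < theta v (ordS i) < 2 * pi) then 1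
  else if (0 < theta v i < pi) && (0 < theta v (ordS i) < pi) then -1
  else 0.

Definition convex_curve v : Prop := forall i, transition v i != 0.

(* pi - theta_i is the signed exterior angle at v_i, positive for left turns;
   the sum is 2 pi times the rotation index, which is -1 for an embedded curve
   with outward normals. *)
Definition clockwise v : Prop := \sum_i (pi - theta v i) < 0.

Definition parallel_curve v w : Prop := forall i,
  [/\ 0 < len (side w i),
      parallel (side v i) (side w i) &
      normal (side w i) = normal (side v i)].

(* F_i is the (unique) facet whose outward normal is that of S_i *)
Definition admissible (phi : plane R -> R) v (F : 'I_n -> oseg R) : Prop :=
  [/\ forall i, is_facet (unit_wulff phi) (F i),
      forall i, normal (side v i) = normal (F i) &
      forall i, common_vertex (F (ord_pred i)) (F i)].

End PolygonalCurves.

Section Flow.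
Variables (R : realType) (phi : plane R -> R) (alpha : R) (n : nat).
Variables (v0 : 'I_n -> plane R) (F : 'I_n -> oseg R).

Definition cot (x : R) : R := cos x / sin x.

Definition delta (i : 'I_n) : R :=
  len (F i) ^+ 2 * dual phi (normal (side v0 i)).

(* The angles, normals and transition numbers are those of v0, which all curves
   parallel to v0 share; only the lengths are those of v. *)
Definition velocity (v : 'I_n -> plane R) (i : 'I_n) : R :=
  let L j := len (side v j) in
  let c := transition v0 in
  let th := theta v0 in
  - (c i * len (F i) / L i)
  - alpha / L i *
    (c (ord_pred i) ^+ 2 * delta (ord_pred i)
       / (L (ord_pred i) ^+ 2 * sin (th i))
     + c i ^+ 2 * delta i * (cot (th i) + cot (th (ordS i))) / L i ^+ 2
     + c (ordS i) ^+ 2 * delta (ordS i)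
       / (L (ordS i) ^+ 2 * sin (th (ordS i)))).

Definition height (v : 'I_n -> plane R) (i : 'I_n) : R :=
  dot (offset (side v0 i) (side v i)) (normal (side v0 i)).

Definition elastic_flow (T : \bar R) (G : R -> 'I_n -> plane R) : Prop :=
  [/\ (0 < T)%E,
      forall t : R, 0 <= t -> (t%:E < T)%E -> parallel_curve v0 (G t) &
      forall i, let h := fun t => height (G t) i in
        [/\ {within [set t : R | 0 <= t /\ (t%:E < T)%E], continuous h},
            h 0 = 0 &
            forall t : R, 0 < t -> (t%:E < T)%E ->
              [/\ derivable h t 1,
                  {for t, continuous (derive1 h)} &
                  derive1 h t / dual phi (normal (side v0 i))
                    = velocity (G t) i]]].

Definition maximal_elastic_flow (T : \bar R) (G : R -> 'I_n -> plane R) : Prop :=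
  elastic_flow T G /\ forall T' G', elastic_flow T' G' -> (T' <= T)%E.

End Flow.

Section Kuratowski.
Variables (R : realType) (E : topologicalType).
Implicit Types (A : R -> set E) (B : set E).

Definition kuratowski_liminf A : set E :=
  [set x | forall U, nbhs x U -> \forall t \near +oo, A t `&` U !=set0].

Definition kuratowski_limsup A : set E :=
  [set x | forall U, nbhs x U ->
     forall M : R, exists2 t, M < t & A t `&` U !=set0].

Definition kuratowski_cvg A B : Prop :=
  kuratowski_liminf A = B /\ kuratowski_limsup A = B.

End Kuratowski.

(* Main.v *)
(* Let h_i be the signed heights, x_i = <v_i, N_i> the support numbers, and A the
   symmetric cyclic matrix taking support numbers to signed side lengths, so
   L = A x.  The facets of the Wulff shape form a polygon with the same normals,
   hence A w = H^1(F) for w_i = phi^o(N_i).  With rho_i = sqrt alpha H^1(F_i) and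
   z_i = w_i (1 - rho_i^2 / L_i^2), the flow reads h' = - (w / L) A z: it is a
   gradient flow of the energy sum_i w_i (L_i - rho_i)^2 / L_i, whose derivative
   is - sum_i (w_i / L_i) (A z)_i^2.  Energy bounds pinch the L_i between positive
   constants, which gives global existence by Picard-Lindelof for a clamped field.
   The energy is at most <z, L - rho> = <A z, y> whenever A y = L - rho, and y can
   be chosen of size O(|L - rho|) by fixing a vertex; hence energy is bounded by
   dissipation and decays exponentially, so do the speeds |h'|, and the vertices
   converge.  The limit has side lengths rho, so it is a translate of the facet
   polygon scaled by sqrt alpha; since det (f_i, f_(i+1)) < 0 along its vertices,
   that polygon meets every direction and is the whole boundary. *)
Require Import Defs.
From HB Require Import structures.
From mathcomp Require Import all_boot all_order all_algebra.
From mathcomp Require Import all_classical all_reals all_analysis.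
From mathcomp Require Import ring lra.

Import Order.TTheory GRing.Theory Num.Theory.
Import numFieldNormedType.Exports.

Local Open Scope classical_set_scope.
Local Open Scope ring_scope.

(** * Picard iteration *)

Section Calculus.
Variable R : realType.
Implicit Types (u v g : R -> R).

Lemma is_derive_continuous u (x d : R) : is_derive x 1 u d -> {for x, continuous u}.
Proof.
by move=> [ud _]; apply/differentiable_continuous/derivable1_diffP.
Qed.

(** The free base point [a] matters: for negative [a] the primitive is differentiable at 0 from both
    sides, and subtracting [I 0] normalises it there. *)
Lemma continuous_antiderivative g (a : R) : continuous g ->
  exists H : R -> R, H 0 = 0 /\ forall x, a < x -> is_derive x 1 H (g x).
Proof.
move=> cg; pose I x := (\int[@lebesgue_measure R]_(t in [set` `[a, x]]) g t)%R.
exists (fun x => I x - I 0); split; first by rewrite subrr.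
move=> x ax.
have [dI eI] : derivable I x 1 /\ derive1 I x = g x.
  apply: (@continuous_FTC1_closed _ _ _ _ (x + 1)) => //.
  - by rewrite ltrDl.
  - apply: continuous_compact_integrable; first exact: segment_compact.
    exact: continuous_subspaceT.
  - exact: cg.
have Ix : is_derive x 1 I (g x) by apply: DeriveDef; [exact: dI|rewrite -derive1E].
rewrite -[g x]subr0.
exact: is_deriveB Ix (is_derive_cst (I 0) x 1).
Qed.

Lemma ge0_derive_le u (u' : R -> R) (a b : R) : a <= b ->
  (forall t, a <= t <= b -> is_derive t 1 u (u' t)) ->
  (forall t, a <= t <= b -> 0 <= u' t) -> u a <= u b.
Proof.
move=> ab du u'0.
have [||c /[!in_itv]/= cab e] := @MVT_segment R u u' a b ab.
- move=> x /[!in_itv]/= /andP[ax xb].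
  by apply: du; rewrite !ltW.
- apply: continuous_in_subspaceT => x; rewrite inE /= in_itv/= => xab.
  exact: is_derive_continuous (du _ xab).
- by rewrite -subr_ge0 e mulr_ge0 ?u'0 // subr_ge0.
Qed.

(** Both [v - u] and [v + u] have nonnegative derivative and start nonnegative. *)
Lemma derive_le_bound u v (u' v' : R -> R) (t : R) : 0 <= t ->
  (forall s, 0 <= s <= t -> is_derive s 1 u (u' s)) ->
  (forall s, 0 <= s <= t -> is_derive s 1 v (v' s)) ->
  (forall s, 0 <= s <= t -> `|u' s| <= v' s) ->
  `|u 0| <= v 0 -> `|u t| <= v t.
Proof.
move=> t0 du dv uv; rewrite !ler_norml => /andP[h1 h2].
have A : (v - u) 0 <= (v - u) t.
  apply: (@ge0_derive_le _ (fun s => v' s - u' s)) => // s st.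
    exact: is_deriveB (dv s st) (du s st).
  by rewrite subr_ge0 (le_trans _ (uv s st))// ler_norm.
have B : (v + u) 0 <= (v + u) t.
  apply: (@ge0_derive_le _ (fun s => v' s + u' s)) => // s st.
    exact: is_deriveD (dv s st) (du s st).
  by have := uv s st; rewrite ler_norml => /andP[+ _]; lra.
move: A B; rewrite !fctE => A B; apply/andP; split; lra.
Qed.

End Calculus.

Section Geometric.
Variable R : realType.

Lemma exists_div_exp2_le (C e : R) : 0 < e -> exists k, C / 2 ^+ k <= e.
Proof.
move=> e0; pose k := Num.bound `|C / e|; exists k.
have h1 : `|C / e| < k%:R by exact: archi_boundP.
have h2 : k%:R <= 2 ^+ k :> R.
  by rewrite -[2 ^+ k]natrX ler_nat; apply: ltnW; exact: ltn_expl.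
rewrite ler_pdivrMr ?exprn_gt0// mulrC -ler_pdivrMr//.
exact: le_trans (ler_norm _) (le_trans (ltW h1) h2).
Qed.

(** The intervals of radius [e k] around [u k] are nested, because [e k - e k.+1] is exactly the
    bound on the [k]-th increment; the supremum of their left ends lies in all of them. *)
Lemma geometric_limit (u : nat -> R) (C : R) :
  (forall k, `|u k.+1 - u k| <= C / 2 ^+ k) ->
  exists l, forall k, `|u k - l| <= 2 * C / 2 ^+ k.
Proof.
move=> uC; pose e k := 2 * C / 2 ^+ k.
have eS k : e k - e k.+1 = C / 2 ^+ k.
  by rewrite /e exprS; field; rewrite expf_neq0.
have C0 : 0 <= C by have := uC 0%N; rewrite expr0 divr1; exact: le_trans.
have e0 k : 0 <= e k by rewrite /e divr_ge0 ?exprn_ge0// mulr_ge0.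
have lo : {homo (fun k => u k - e k) : i j / (i <= j)%N >-> i <= j}.
  apply: homo_leq => [x|y x z|k]; [exact: lexx|exact: le_trans|].
  by have := uC k; rewrite -eS ler_norml => /andP[]; lra.
have hi : {homo (fun k => - (u k + e k)) : i j / (i <= j)%N >-> i <= j}.
  apply: homo_leq => [x|y x z|k]; [exact: lexx|exact: le_trans|].
  by have := uC k; rewrite -eS ler_norml => /andP[]; lra.
have ub k : ubound (range (fun k => u k - e k)) (u k + e k).
  move=> _ [j _ <-]; have := lo j (maxn j k) (leq_maxl _ _).
  have := hi k (maxn j k) (leq_maxr _ _).
  by have := e0 (maxn j k); lra.
exists (sup (range (fun k => u k - e k))) => k.
have h1 : u k - e k <= sup (range (fun k => u k - e k)).
  by apply: ub_le_sup; [exists (u k + e k); exact: ub|exists k].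
have h2 : sup (range (fun k => u k - e k)) <= u k + e k.
  by apply: ge_sup; [exists (u k - e k), k|exact: ub].
by rewrite -/(e k) ler_norml; apply/andP; split; lra.
Qed.

End Geometric.

(** * Global Picard-Lindelof theorem for Lipschitz fields *)

Section Picard.
Variables (R : realType) (n : nat).
Implicit Types (f : ('I_n -> R) -> 'I_n -> R).

Definition sup_lipschitz (K : R) f := forall (r : R) (x y : 'I_n -> R),
  (forall i, `|x i - y i| <= r) -> forall i, `|f x i - f y i| <= K * r.

Lemma sup_lipschitz_continuous (T : topologicalType) K f (X : T -> 'I_n -> R) (t : T) :
  0 < K -> sup_lipschitz K f ->
  (forall i, {for t, continuous (X^~ i)}) ->
  forall i, {for t, continuous (fun s => f (X s) i)}.
Proof.
move=> K0 fK cX i; apply/cvgrPdist_le => e e0.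
have : \forall s \near t, forall j, `|X t j - X s j| <= e / K.
  apply: filter_forall => j; have /cvgrPdist_le := cX j.
  by apply; exact: divr_gt0.
apply: filterS => s hs; have := fK _ _ _ hs i.
by rewrite mulrCA divff ?gt_eqF// mulr1.
Qed.

Lemma fin_ub (F : 'I_n -> R) : exists2 C, 0 < C & forall i, F i <= C.
Proof.
exists (1 + \sum_i `|F i|); first by rewrite ltr_pwDl// sumr_ge0.
move=> i; rewrite (bigD1 i)//= (le_trans (ler_norm _))//.
by rewrite addrCA lerDl addr_ge0 ?sumr_ge0.
Qed.

Lemma fin_lb (F : 'I_n -> R) : (forall i, 0 < F i) ->
  exists2 c, 0 < c & forall i, c <= F i.
Proof.
move=> F0; have [C C0 FC] := fin_ub (fun i => (F i)^-1).
exists C^-1; first by rewrite invr_gt0.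
by move=> i; rewrite -[F i]invrK lef_pV2 ?posrE ?invr_gt0.
Qed.

Variables (K : R) (f : ('I_n -> R) -> 'I_n -> R).
Hypotheses (K0 : 0 < K) (fK : sup_lipschitz K f).

(* Primitives on (-1, +oo), so that derivatives at 0 are two-sided; the fields
   are extended to negative times by freezing time at 0. *)
Let prim (g : R -> R) : R -> R :=
  xget (fun=> 0) [set H : R -> R | H 0 = 0 /\ forall x : R, -1 < x -> is_derive x 1 H (g x)].

Let primP (g : R -> R) : continuous g ->
  prim g 0 = 0 /\ forall x : R, -1 < x -> is_derive x 1 (prim g) (g x).
Proof.
move=> /(continuous_antiderivative _ _ (-1)) [H HP].
exact: (@xgetPex _ (fun=> 0) [set H : R -> R | H 0 = 0 /\ forall x : R, -1 < x -> is_derive x 1 H (g x)]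
  (ex_intro _ H HP)).
Qed.

Let clampf (X : R -> 'I_n -> R) i := fun s : R => f (X (Num.max s 0)) i.

Let reg (X : R -> 'I_n -> R) := forall i, continuous (fun s : R => X (Num.max s 0) i).

Let max0_cont (t : R) : {for t, continuous (fun s : R => Num.max s 0)}.
Proof.
apply: (@continuous_max _ _ id (cst 0) t); [exact: cvg_id|exact: cvg_cst].
Qed.

Let clampf_cont X : reg X -> forall i, continuous (clampf X i).
Proof.
move=> cX i t.
apply: (@sup_lipschitz_continuous R K f (fun s : R => X (Num.max s 0)) t K0 fK _ i) => j.
exact: cX.
Qed.

Let step (X : R -> 'I_n -> R) : R -> 'I_n -> R := fun t i => prim (clampf X i) t.

Let stepP X : reg X ->
  [/\ forall i, step X 0 i = 0,
      forall i (t : R), 0 <= t -> is_derive t 1 ((step X)^~ i) (f (X t) i) &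
      reg (step X)].
Proof.
move=> cX.
have P i := primP _ (clampf_cont _ cX i).
have D i (t : R) : 0 <= t -> is_derive t 1 ((step X)^~ i) (f (X t) i).
  move=> t0; have := (P i).2 t; rewrite /clampf max_l//; apply.
  by rewrite (lt_le_trans _ t0)// ltrN10.
split => // [i|i t]; first exact: (P i).1.
apply: (@continuous_comp _ _ _ (fun s : R => Num.max s 0) ((step X)^~ i)).
  exact: max0_cont.
by apply: is_derive_continuous (D i _ _); rewrite le_max lexx orbT.
Qed.

Let p k := iter k step (fun _ _ => 0).

Let p_reg k : reg (p k).
Proof.
elim: k => [|k IH]; first by move=> i; exact: cst_continuous.
by have [_ _] := stepP _ IH.
Qed.

Let is_derive_exp2K (C t : R) :
  is_derive t 1 (fun s => C * expR (2 * K * s)) (2 * K * (C * expR (2 * K * t))).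
Proof.
have H1 : is_derive t 1 (fun s : R => 2 * K * s) (2 * K).
  have := is_deriveZ (2 * K) (is_derive_id t (1 : R)).
  by rewrite scaler1.
have H2 := is_derive1_comp (is_derive_expR (2 * K * t)) H1.
have -> : 2 * K * (C * expR (2 * K * t)) = C *: (expR (2 * K * t) * (2 * K)).
  by rewrite /GRing.scale/=; ring.
have H3 := is_deriveZ C H2.
exact H3.
Qed.

(* A Picard step contracts by 1/2 in the norm with weight exp (2 K t). *)
Let contract X Y (M : R) :
  reg X -> reg Y -> 0 <= M ->
  (forall i (t : R), 0 <= t -> `|X t i - Y t i| <= M * expR (2 * K * t)) ->
  forall i (t : R), 0 <= t ->
    `|step X t i - step Y t i| <= M / 2 * expR (2 * K * t).
Proof.
move=> cX cY M0 XY i t t0.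
have [X0 dX _] := stepP _ cX; have [Y0 dY _] := stepP _ cY.
apply: (@derive_le_bound _ (fun t => step X t i - step Y t i) _
  (fun s => f (X s) i - f (Y s) i) _ t t0 _
  (fun s _ => is_derive_exp2K (M / 2) s)).
- move=> s /andP[s0 _]; exact: is_deriveB (dX i s s0) (dY i s s0).
- move=> s /andP[s0 _].
  have -> : 2 * K * (M / 2 * expR (2 * K * s)) = K * (M * expR (2 * K * s)) by field.
  exact: (fK _ _ _ (fun j => XY j s s0)).
- by rewrite X0 Y0 subrr normr0 mulr_ge0 ?expR_ge0// divr_ge0.
Qed.

(** The weight exp (2 K t) makes the iteration contract on the whole half-line, so the iterates
    converge for all times at once and no local solutions have to be glued. *)
Lemma picard_lindelof : exists h : R -> 'I_n -> R, (forall i, h 0 i = 0) /\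
  forall (t : R), 0 <= t -> forall i, is_derive t 1 (h^~ i) (f (h t) i).
Proof.
have [C C0 fC] := fin_ub (fun i => `|f (fun=> 0) i|).
(* With this [M] the weighted bound has derivative C exp (2 K t), which dominates the speed [f 0] of
   the first iterate. *)
pose M := C / (2 * K).
have M0 : 0 < M by rewrite divr_gt0// mulr_gt0.
have geo k i (t : R) : 0 <= t ->
    `|p k.+1 t i - p k t i| <= M / 2 ^+ k * expR (2 * K * t).
  elim: k i t => [|k IH] i t t0; last first.
    have -> : M / 2 ^+ k.+1 = M / 2 ^+ k / 2 by rewrite exprS; field; rewrite expf_neq0.
    have Mk : 0 <= M / 2 ^+ k by rewrite divr_ge0 ?exprn_ge0// ltW.
    exact: (contract (p k.+1) (p k) (M / 2 ^+ k) (p_reg _) (p_reg _) Mk IH).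
  have [X0 dX _] := stepP _ (p_reg 0).
  rewrite expr0 divr1 subr0.
  apply: (@derive_le_bound _ (fun t => step (p 0) t i) _
    (fun s => f (p 0 s) i) _ t t0 _ (fun s _ => is_derive_exp2K M s)).
  - by move=> s /andP[s0 _]; exact: dX.
  - move=> s /andP[s0 _].
    rewrite mulrA [2 * K * M]mulrC divfK ?gt_eqF ?mulr_gt0//.
    have e1 : expR 0 <= expR (2 * K * s) by rewrite ler_expR !mulr_ge0 ?(ltW K0).
    by rewrite expR0 in e1; rewrite (le_trans (fC i))// ler_peMr// ltW.
  - by rewrite X0 normr0 mulr_ge0 ?expR_ge0// ltW.
have lim (ti : R * 'I_n) : exists l, 0 <= ti.1 ->
    forall k, `|p k ti.1 ti.2 - l| <= 2 * (M * expR (2 * K * ti.1)) / 2 ^+ k.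
  case: ti => t i /=; have [t0|t0] := leP 0 t; last by exists 0.
  have [|l hl] := @geometric_limit R (fun k => p k t i) (M * expR (2 * K * t)).
    by move=> k; rewrite mulrAC; exact: geo.
  by exists l.
have [h0 h0P] := choice lim.
pose h t i := h0 (t, i).
have hP k i (t : R) : 0 <= t -> `|p k t i - h t i| <= 2 * M / 2 ^+ k * expR (2 * K * t).
  by move=> t0; rewrite (le_trans (h0P (t, i) t0 k))//= mulrA mulrAC.
(* Three-epsilon argument: the convergence is uniform up to time [Num.max t 0 + 1], where the weight
   is at most [B]. *)
have hreg : reg h.
  move=> i t; apply/cvgrPdist_le => e e0.
  have m0 (s : R) : 0 <= Num.max s 0 by rewrite le_max lexx orbT.
  pose B := expR (2 * K * (Num.max t 0 + 1)).
  have [k kB] := @exists_div_exp2_le R (2 * M * B) (e / 3) (divr_gt0 e0 (ltr0Sn _ 2)).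
  have /cvgrPdist_le /(_ (e / 3) (divr_gt0 e0 (ltr0Sn _ 2))) pk := p_reg k i t.
  have /cvgrPdist_le /(_ 1 ltr01) mt := max0_cont t.
  near=> s.
  have hs (r : R) : 0 <= r -> r <= Num.max t 0 + 1 -> `|p k r i - h r i| <= e / 3.
    move=> r0 r1; rewrite (le_trans (hP k i r r0))// (le_trans _ kB)// [leRHS]mulrAC.
    apply: ler_wpM2l; first by rewrite divr_ge0 ?exprn_ge0// mulr_ge0 ?(ltW M0).
    by rewrite /B ler_expR ler_pM2l ?mulr_gt0.
  have st : `|Num.max t 0 - Num.max s 0| <= 1 by near: s.
  have A1 : `|p k (Num.max t 0) i - h (Num.max t 0) i| <= e / 3.
    by apply: hs; rewrite ?m0// lerDl.
  have A2 : `|p k (Num.max s 0) i - h (Num.max s 0) i| <= e / 3.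
    by apply: hs; rewrite ?m0//; move: st; rewrite ler_norml; lra.
  have A3 : `|p k (Num.max t 0) i - p k (Num.max s 0) i| <= e / 3 by near: s.
  move: A1 A2 A3; rewrite !ler_norml => /andP[? ?] /andP[? ?] /andP[? ?].
  by apply/andP; split; lra.
have [H0 dH _] := stepP _ hreg.
(* The witness is [step h] and not [h]: the two agree at nonnegative times, but [h] is arbitrary at
   negative ones, which would spoil the two-sided derivative at 0. *)
exists (step h); split => // t t0 i.
suff -> : step h t = h t by exact: dH.
apply/funext => j; apply/eqP; rewrite -subr_eq0 -normr_le0.
apply/ler_addgt0Pr => e e0; rewrite add0r.
have [k ke] := @exists_div_exp2_le R (2 * M * expR (2 * K * t)) e e0.
have B1 : `|step (p k) t j - step h t j| <= 2 * M / 2 ^+ k / 2 * expR (2 * K * t).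
  have Mk : 0 <= 2 * M / 2 ^+ k by rewrite divr_ge0 ?exprn_ge0// mulr_ge0 ?ltW.
  exact: (contract (p k) h _ (p_reg k) hreg Mk (hP k)).
have := hP k.+1 j t t0; rewrite /= -/(p k) => B2.
have E1 : 2 * M / 2 ^+ k / 2 * expR (2 * K * t) = 2 * M / 2 ^+ k.+1 * expR (2 * K * t).
  by rewrite exprS; field; rewrite expf_neq0.
have E2 : 2 * (2 * M / 2 ^+ k.+1 * expR (2 * K * t)) = 2 * M * expR (2 * K * t) / 2 ^+ k.
  by rewrite exprS; field; rewrite expf_neq0.
move: B1 B2 ke; rewrite E1 -E2 !ler_norml => /andP[? ?] /andP[? ?] ?.
by apply/andP; split; lra.
Unshelve. all: by end_near. Qed.
End Picard.

(** * Cauchy-Schwarz for finite sums and exponential decay *)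

Section Decay.
Variable R : realType.

(** The right side is the double sum of (x_i^2 + x_j^2) / 2, which dominates |x_i| |x_j| term by
    term. *)
Lemma sum_norm_sqr_le (n : nat) (x : 'I_n -> R) :
  (\sum_i `|x i|) ^+ 2 <= n%:R * \sum_i x i ^+ 2.
Proof.
have -> : n%:R * \sum_i x i ^+ 2 = \sum_i \sum_j (x i ^+ 2 + x j ^+ 2) / 2.
  have half : \sum_i \sum_(j < n) x i ^+ 2 / 2 = n%:R * \sum_i x i ^+ 2 / 2.
    by rewrite mulr_sumr; apply: eq_bigr => i _; rewrite sumr_const card_ord mulr_natl.
  under [RHS]eq_bigr do (under eq_bigr do rewrite mulrDl; rewrite big_split/=).
  rewrite big_split/= half [X in _ + X]exchange_big/= half -mulrDr -big_split/=.
  by congr (_ * _); apply: eq_bigr => i _; field.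
rewrite expr2 mulr_suml; apply: ler_sum => i _.
rewrite mulr_sumr; apply: ler_sum => j _.
rewrite -[x i ^+ 2]real_normK ?num_real// -[x j ^+ 2]real_normK ?num_real//.
by have := sqr_ge0 (`|x i| - `|x j|); lra.
Qed.

Lemma cvg_expRN_mul (A mu : R) : 0 < mu ->
  (A * expR (- (mu * t))) @[t --> +oo] --> (0 : R).
Proof.
move=> mu0; rewrite -[X in _ --> X](mulr0 A).
apply: cvgMr; apply: (@cvg_comp _ _ _ (fun t => mu * t) (fun x => expR (- x))); last exact: cvgr_expR.
exact: gt0_cvgMry.
Qed.

(** With [v t] the integral of the bound on the speed from [t] to infinity, [u - v] is nondecreasing
    and [u + v] nonincreasing; hence [u - v] is bounded and converges, and [v] tends to 0. *)
Lemma exp_decay_cvg (u u' : R -> R) (A mu : R) : 0 < mu ->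
  (forall t : R, 1 <= t -> is_derive t 1 u (u' t)) ->
  (forall t : R, 1 <= t -> `|u' t| <= A * expR (- (mu * t))) ->
  exists l : R, u t @[t --> +oo] --> l.
Proof.
move=> mu0 du u'A.
have A0 : 0 <= A.
  by rewrite -(pmulr_lge0 A (expR_gt0 (- (mu * 1)))); exact: le_trans (u'A 1 (lexx 1)).
pose v (t : R) := A / mu * expR (- (mu * t)).
have v0 t : 0 <= v t by rewrite mulr_ge0 ?expR_ge0// divr_ge0// ltW.
have dv (t : R) : is_derive t 1 v (- (A * expR (- (mu * t)))).
  have H1 : is_derive t 1 (fun s : R => - (mu * s)) (- (mu * 1)).
    have H0 := is_deriveN (is_deriveZ mu (is_derive_id t (1 : R))).
    exact H0.
  have H2 := is_deriveZ (A / mu) (@is_derive1_comp R expR (fun s : R => - (mu * s)) t _ _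
    (is_derive_expR (- (mu * t))) H1).
  have -> : - (A * expR (- (mu * t))) = (A / mu) *: (expR (- (mu * t)) * (- (mu * 1))).
    by rewrite /GRing.scale/=; field; rewrite gt_eqF.
  exact H2.
have lo (s t : R) : 1 <= s -> s <= t -> u s - v s <= u t - v t.
  move=> s1 st; apply: (@ge0_derive_le R (fun t => u t - v t)
    (fun t => u' t - - (A * expR (- (mu * t))))) => // r /andP[sr _].
    exact: is_deriveB (du r (le_trans s1 sr)) (dv r).
  by have := u'A r (le_trans s1 sr); rewrite ler_norml => /andP[]; lra.
have hi (s t : R) : 1 <= s -> s <= t -> - (u s + v s) <= - (u t + v t).
  move=> s1 st; apply: (@ge0_derive_le R (fun t => - (u t + v t))
    (fun t => - (u' t + - (A * expR (- (mu * t)))))) => // r /andP[sr _].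
    exact: is_deriveN (is_deriveD (du r (le_trans s1 sr)) (dv r)).
  by have := u'A r (le_trans s1 sr); rewrite ler_norml => /andP[]; lra.
(* Freezing the function before time 1 makes it monotone on the whole line. *)
pose g (t : R) := u (Num.max t 1) - v (Num.max t 1).
have m1 (t : R) : 1 <= Num.max t 1 by rewrite le_max lexx orbT.
have gmono : nondecreasing_fun g.
  by move=> s t st; apply: lo => //; rewrite ge_max le_max st/= le_max lexx orbT.
have gub : has_ubound (range g).
  exists (u 1 + v 1) => _ [t _ <-]; have := hi 1 _ (lexx _) (m1 t).
  by have := v0 (Num.max t 1); rewrite /g; lra.
have gl := nondecreasing_cvgr gmono gub.
exists (sup (range g) + 0).
have : (g t + v t) @[t --> +oo] --> sup (range g) + 0.
  by apply: cvgD => //; exact: cvg_expRN_mul.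
apply: cvg_trans; apply: near_eq_cvg; near=> t.
have t1 : 1 <= t by [].
by rewrite /g max_l// subrK.
Unshelve. all: by end_near. Qed.

End Decay.

(** * The gradient flow in terms of side lengths *)

Section GradientFlow.
Variables (R : realType) (n : nat).
Variables (a : 'I_n -> 'I_n -> R) (w rho : 'I_n -> R).
Hypotheses (a_sym : forall i j, a i j = a j i)
  (w0 : forall i, 0 < w i) (rho0 : forall i, 0 < rho i).
Implicit Types (x y L : 'I_n -> R).

Definition lin x i : R := \sum_j a i j * x j.

(** The partial derivatives of [energy], since (L - rho)^2 / L = L - 2 rho + rho^2 / L. *)
Definition grad L i : R := w i * (1 - rho i ^+ 2 / L i ^+ 2).

Definition flow_field L i : R := - (w i / L i * lin (grad L) i).

Definition energy L : R := \sum_i w i * (L i - rho i) ^+ 2 / L i.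

Definition dissipation L : R := \sum_i w i / L i * lin (grad L) i ^+ 2.

Lemma lin_sym x y : \sum_i x i * lin y i = \sum_i lin x i * y i.
Proof.
under eq_bigr do rewrite mulr_sumr.
under [RHS]eq_bigr do rewrite mulr_suml.
rewrite exchange_big; apply: eq_bigr => i _; apply: eq_bigr => j _.
by rewrite a_sym; ring.
Qed.

Lemma linD x y i : lin (fun j => x j + y j) i = lin x i + lin y i.
Proof. by rewrite /lin -big_split; apply: eq_bigr => j _; rewrite mulrDr. Qed.

Lemma linB x y i : lin (fun j => x j - y j) i = lin x i - lin y i.
Proof. by rewrite /lin -sumrB; apply: eq_bigr => j _; rewrite mulrBr. Qed.

Lemma is_derive_lin (h : R -> 'I_n -> R) (h' : 'I_n -> R) (t : R) (i : 'I_n) :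
  (forall j, is_derive t 1 (h^~ j) (h' j)) ->
  is_derive t 1 (fun s : R => lin (h s) i) (lin h' i).
Proof.
move=> dh.
have := @is_derive_sum R R R n (fun j (s : R) => a i j * h s j) t 1
  (fun j => a i j * h' j) (fun j => is_deriveZ (a i j) (dh j)).
by rewrite fct_sumE.
Qed.

Lemma is_derive_energy (L : R -> 'I_n -> R) (L' : 'I_n -> R) (t : R) :
  (forall i, 0 < L t i) -> (forall i, is_derive t 1 (L^~ i) (L' i)) ->
  is_derive t 1 (fun s : R => energy (L s)) (\sum_i grad (L t) i * L' i).
Proof.
move=> L0 dL.
have term i : is_derive t 1 (fun s : R => w i * (L s i - rho i) ^+ 2 / L s i)
    (grad (L t) i * L' i).
  have Li : L t i != 0 by rewrite gt_eqF.
  have d1 := is_deriveB (dL i) (is_derive_cst (rho i) t 1).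
  have d2 := is_deriveZ (w i) (is_deriveX 2 d1).
  have d3 := is_deriveM d2 (is_deriveV Li (dL i)).
  apply: (@is_derive_eq _ _ _ _ _ _ _ _ d3).
  rewrite /grad !fctE /GRing.scale/=.
  rewrite -[w i *: _]/(w i * _). by field.
have := @is_derive_sum R R R n _ t 1 _ term.
by rewrite fct_sumE.
Qed.

Lemma sum_grad_flow_field L : \sum_i grad L i * lin (flow_field L) i = - dissipation L.
Proof.
rewrite lin_sym -sumrN; apply: eq_bigr => i _; rewrite /flow_field; ring.
Qed.

Lemma dissipation_ge0 L : (forall i, 0 < L i) -> 0 <= dissipation L.
Proof.
by move=> L0; apply: sumr_ge0 => i _; rewrite mulr_ge0 ?sqr_ge0// divr_ge0// ltW.
Qed.

(** A bound on (L - rho)^2 / L is one on L + rho^2 / L; the first summand bounds L from above, the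
    second from below. *)
Lemma energy_sublevel (E : R) : exists m M : R, [/\ 0 < m, 0 < M &
  forall L, (forall i, 0 < L i) -> energy L <= E -> forall i, m <= L i <= M].
Proof.
have [M M0 hM] := fin_ub R n (fun i => E / w i + 2 * rho i).
have [c c0 hc] := fin_lb R n (fun i => rho i ^+ 2) (fun i => exprn_gt0 2 (rho0 i)).
exists (c / M), M; split => //; first exact: divr_gt0.
move=> L L0 LE i.
have key : L i + rho i ^+ 2 / L i <= M.
  apply: le_trans (hM i).
  have : w i * (L i - rho i) ^+ 2 / L i <= E.
    apply: le_trans LE; rewrite /energy (bigD1 i)//= lerDl sumr_ge0// => j _.
    exact: (divr_ge0 (mulr_ge0 (ltW (w0 j)) (sqr_ge0 _)) (ltW (L0 j))).
  rewrite -mulrA -ler_pdivlMl// => h.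
  have -> : L i + rho i ^+ 2 / L i = (L i - rho i) ^+ 2 / L i + 2 * rho i.
    by field; rewrite gt_eqF.
  by rewrite lerD2r (le_trans h)// mulrC.
have r0 : 0 <= rho i ^+ 2 / L i by rewrite divr_ge0 ?sqr_ge0 ?(ltW (L0 i)).
have LM : L i <= M by rewrite (le_trans _ key)// lerDl.
rewrite LM andbT ler_pdivrMr// (le_trans (hc i))// -ler_pdivrMl//.
by rewrite mulrC (le_trans _ key)// lerDr ltW.
Qed.

(** Boundedness is included so that the class is closed under products; the clamped field is then
    built from reciprocals by sums and products. *)
Definition bounded_lipschitz (g : ('I_n -> R) -> R) : Prop :=
  exists2 C, 0 < C & (forall x, `|g x| <= C) /\
    forall (r : R) x y, 0 <= r -> (forall i, `|x i - y i| <= r) ->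
      `|g x - g y| <= C * r.

Lemma bounded_lipschitz_cst (c : R) : bounded_lipschitz (fun=> c).
Proof.
exists (`|c| + 1); first by rewrite ltr_wpDl.
split=> [x|r x y r0 _]; first by rewrite lerDl.
by rewrite subrr normr0 mulr_ge0// addr_ge0.
Qed.

Lemma bounded_lipschitzD g1 g2 : bounded_lipschitz g1 -> bounded_lipschitz g2 ->
  bounded_lipschitz (fun x => g1 x + g2 x).
Proof.
move=> [C C0 [bC lC]] [D D0 [bD lD]]; exists (C + D); first exact: addr_gt0.
split=> [x|r x y r0 h]; first exact: le_trans (ler_normD _ _) (lerD (bC x) (bD x)).
rewrite mulrDl (_ : _ - _ = (g1 x - g1 y) + (g2 x - g2 y)); last by ring.
exact: le_trans (ler_normD _ _) (lerD (lC r x y r0 h) (lD r x y r0 h)).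
Qed.

Lemma bounded_lipschitzM g1 g2 : bounded_lipschitz g1 -> bounded_lipschitz g2 ->
  bounded_lipschitz (fun x => g1 x * g2 x).
Proof.
move=> [C C0 [bC lC]] [D D0 [bD lD]].
have CD : 0 < C * D by exact: mulr_gt0.
exists (C * D + C * D); first exact: addr_gt0.
split=> [x|r x y r0 h].
  by rewrite normrM (le_trans (ler_pM _ _ (bC x) (bD x)))// lerDl ltW.
have -> : g1 x * g2 x - g1 y * g2 y = g1 x * (g2 x - g2 y) + (g1 x - g1 y) * g2 y.
  by ring.
rewrite (le_trans (ler_normD _ _))// !normrM mulrDl lerD//.
  by rewrite -mulrA ler_pM// lD.
by rewrite mulrAC ler_pM// lC.
Qed.

Lemma bounded_lipschitz_sum (g : 'I_n -> ('I_n -> R) -> R) :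
  (forall j, bounded_lipschitz (g j)) -> bounded_lipschitz (fun x => \sum_j g j x).
Proof.
move=> gb; elim: (index_enum _) => [|j s IH].
  rewrite (_ : (fun x => _) = (fun=> 0)); first exact: bounded_lipschitz_cst.
  by apply/funext => x; rewrite big_nil.
rewrite (_ : (fun x => _) = (fun x => g j x + \sum_(k <- s) g k x)).
  exact: bounded_lipschitzD.
by apply/funext => x; rewrite big_cons.
Qed.

Lemma bounded_lipschitz_clamp_inv (L0 : 'I_n -> R) (m : R) i : 0 < m ->
  bounded_lipschitz (fun x => (Num.max m (L0 i + lin x i))^-1).
Proof.
move=> m0; pose q x := Num.max m (L0 i + lin x i).
have qm x : m <= q x by rewrite le_max lexx.
have q0 x : 0 < q x by exact: lt_le_trans (qm x).
pose B := \sum_j `|a i j|; have B0 : 0 <= B by exact: sumr_ge0.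
have Bl (r : R) x y : (forall j, `|x j - y j| <= r) -> `|q x - q y| <= B * r.
  move=> h; have : `|lin x i - lin y i| <= B * r.
    rewrite -linB /lin (le_trans (ler_norm_sum _ _ _))// mulr_suml ler_sum// => j _.
    by rewrite normrM ler_wpM2l.
  rewrite /q /Num.max /Order.max /= !ler_norml => /andP[h1 h2].
  case: ltP => h3; case: ltP => h4; apply/andP; split; lra.
have im0 : 0 < m^-1 by rewrite invr_gt0.
exists (m^-1 + m^-1 * m^-1 * B); first by rewrite ltr_wpDr// !mulr_ge0// ltW.
have iq x : `|(q x)^-1| <= m^-1 by rewrite gtr0_norm ?invr_gt0// lef_pV2 ?posrE.
split=> [x|r x y r0 h]; first by rewrite (le_trans (iq x))// lerDl !mulr_ge0// ltW.
have -> : (q x)^-1 - (q y)^-1 = (q x)^-1 * (q y)^-1 * (q y - q x).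
  by field; rewrite !gt_eqF.
rewrite mulrDl (@le_trans _ _ (m^-1 * m^-1 * (B * r)))//; last first.
  by rewrite mulrA lerDr mulr_ge0// ltW.
rewrite !normrM; apply: ler_pM; rewrite ?mulr_ge0//; first exact: ler_pM.
by rewrite distrC Bl.
Qed.

Lemma clamped_field_lipschitz (L0 : 'I_n -> R) (m : R) : 0 < m ->
  exists2 K, 0 < K & sup_lipschitz R n K
    (fun x => flow_field (fun i => Num.max m (L0 i + lin x i))).
Proof.
move=> m0; pose iq i x := (Num.max m (L0 i + lin x i))^-1.
have bl i : bounded_lipschitz
    (fun x => flow_field (fun i => Num.max m (L0 i + lin x i)) i).
  rewrite (_ : (fun x => _) = fun x => (- w i) * (iq i x *
     \sum_j a i j * (w j * (1 + (- rho j ^+ 2) * (iq j x * iq j x))))); last first.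
    apply/funext => x; rewrite /flow_field -/(iq i x) -mulrA mulNr; congr (- (_ * (_ * _))).
    rewrite /lin; apply: eq_bigr => j _; congr (_ * (_ * _)).
    by rewrite mulNr -expr2 exprVn.
  have c := bounded_lipschitz_cst.
  have iqb j := bounded_lipschitz_clamp_inv L0 m j m0.
  apply: bounded_lipschitzM _ _ (c _) (bounded_lipschitzM _ _ (iqb i) _).
  apply: bounded_lipschitz_sum => j.
  apply: bounded_lipschitzM _ _ (c _) (bounded_lipschitzM _ _ (c _) _).
  apply: bounded_lipschitzD _ _ (c _) (bounded_lipschitzM _ _ (c _) _).
  exact: bounded_lipschitzM _ _ (iqb j) (iqb j).
have : forall i, exists C, 0 < C /\ forall (r : R) x y, 0 <= r ->
    (forall i, `|x i - y i| <= r) ->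
    `|flow_field (fun i => Num.max m (L0 i + lin x i)) i -
      flow_field (fun i => Num.max m (L0 i + lin y i)) i| <= C * r.
  by move=> i; have [C C0 [_ h]] := bl i; exists C.
move=> /choice[C CP]; have [K K0 KC] := fin_ub R n C.
exists K => // r x y h i.
have r0 : 0 <= r by exact: le_trans (h i).
by apply: le_trans ((CP i).2 r x y r0 h) _; rewrite ler_wpM2r.
Qed.

Lemma energy_le (L L' : R -> 'I_n -> R) (s t : R) : s <= t ->
  (forall u, s <= u <= t -> forall i, 0 < L u i) ->
  (forall u, s <= u <= t -> forall i, is_derive u 1 (L^~ i) (lin (flow_field (L u)) i)) ->
  energy (L t) <= energy (L s).
Proof.
move=> st L0 dL; rewrite -lerN2.
apply: (@ge0_derive_le R (fun u => - energy (L u)) (fun u => dissipation (L u))) => //.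
  move=> u su; rewrite -[dissipation _]opprK -sum_grad_flow_field.
  exact: is_deriveN (is_derive_energy _ _ _ (L0 u su) (dL u su)).
by move=> u su; apply: dissipation_ge0; exact: L0.
Qed.

(** The field with lengths clamped from below at [k] has a global solution. While all lengths are at
    least [k] the clamp is inactive, so the energy decreases and the lengths are in fact at least
    [m]. As [k < m], continuity forbids them ever to drop below [k]. *)
Lemma global_flow (L0 : 'I_n -> R) : (forall i, 0 < L0 i) ->
  exists h : R -> 'I_n -> R, (forall i, h 0 i = 0) /\
    forall t : R, 0 <= t -> (forall i, 0 < L0 i + lin (h t) i) /\
      forall i, is_derive t 1 (h^~ i) (flow_field (fun j => L0 j + lin (h t) j) i).
Proof.
move=> L00; have [m [M [m0 M0 mM]]] := energy_sublevel (energy L0).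
pose k := m / 2; have k0 : 0 < k by rewrite divr_gt0.
have [K K0 fK] := clamped_field_lipschitz L0 k k0.
have [h [h0 dh]] := picard_lindelof R n K _ K0 fK.
exists h; split=> //.
pose L (t : R) i := L0 i + lin (h t) i.
pose bad := [set t : R | 0 <= t /\ exists i, L t i < k].
have L_0 : L 0 = L0.
  by apply/funext => i; rewrite /L /lin big1 ?addr0// => j _; rewrite h0 mulr0.
have good_dL (t : R) : 0 <= t -> (forall i, k <= L t i) ->
    forall i, is_derive t 1 (h^~ i) (flow_field (L t) i).
  move=> t0 tg i; have := dh t t0 i.
  rewrite (_ : (fun j => Num.max _ _) = L t)//.
  by apply/funext => j; rewrite max_r// tg.
have dL (t : R) : 0 <= t -> forall x, (forall i, is_derive t 1 (h^~ i) (x i)) ->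
    forall i, is_derive t 1 (L^~ i) (lin x i).
  move=> t0 x hx i; rewrite -[lin x i]add0r.
  exact: is_deriveD (is_derive_cst (L0 i) t 1) (is_derive_lin h x t i hx).
have good (t : R) : 0 <= t -> (forall s, 0 <= s <= t -> forall i, k <= L s i) ->
    forall i, m <= L t i.
  move=> t0 tg i; have kl s : 0 <= s <= t -> forall j, 0 < L s j.
    by move=> st j; exact: lt_le_trans (tg s st j).
  have E : energy (L t) <= energy L0.
    rewrite -[in leRHS]L_0; apply: (energy_le L L 0 t t0 kl) => u ut j.
    have u0 : 0 <= u by case/andP: ut.
    exact: dL (good_dL u u0 (tg u ut)) j.
  have Lt j : 0 < L t j by apply: kl; rewrite t0 lexx.
  by have /andP[] := mM (L t) Lt E i.
have cL i (t : R) : 0 <= t -> {for t, continuous (L^~ i)}.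
  by move=> t0; apply: is_derive_continuous (dL t t0 _ (dh t t0) i).
suff nobad (t : R) : 0 <= t -> forall i, k <= L t i.
  move=> t t0; split; last exact: good_dL t t0 (nobad t t0).
  by move=> i; exact: lt_le_trans (nobad t t0 i).
move=> t0 i; rewrite leNgt; apply/negP => Ltk.
have ne : bad !=set0 by exists t; split => //; exists i.
have lb0 : lbound bad 0 by move=> s [].
(* The first time at which the clamp could become active. *)
pose u := inf bad.
have u0 : 0 <= u by exact: lb_le_inf.
have below (s : R) : 0 <= s < u -> forall j, k <= L s j.
  move=> /andP[s0 su] j; rewrite leNgt; apply/negP => Lsk.
  have : u <= s by apply: ge_inf; [exists 0|split=> //; exists j].
  by rewrite leNgt su.
have near_u (e : R) : 0 < e -> exists2 d, 0 < d & forall s : R, `|u - s| < d ->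
    forall j, `|L u j - L s j| < e.
  move=> e0; have : \forall s \near u, forall j, `|L u j - L s j| < e.
    apply: (@filter_forall _ _ _ (nbhs u)) => j; have /cvgrPdist_lt := cL j u u0.
    exact.
  by move=> /nbhs_ballP[d d0 hd]; exists d.
have km : k < m by rewrite /k; lra.
(* If [u] is positive, a length below [k] at [u] would already be below [k] slightly earlier; the
   minimum with [u] keeps that earlier time nonnegative. *)
have ku j : k <= L u j.
  have [u00|un0] := eqVneq u 0.
    rewrite u00 L_0; have /(_ j)/andP[+ _] := mM L0 L00 (lexx _).
    exact: le_trans (ltW km).
  rewrite leNgt; apply/negP => Luk.
  have [d d0 hd] := near_u (k - L u j) ltac:(by rewrite subr_gt0).
  have up : 0 < u by rewrite lt_neqAle eq_sym un0.
  pose s := u - Num.min u (d / 2).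
  have mn : 0 < Num.min u (d / 2) by rewrite lt_min up divr_gt0.
  have mu : Num.min u (d / 2) <= u by rewrite ge_min lexx.
  have md : Num.min u (d / 2) <= d / 2 by rewrite ge_min lexx orbT.
  have s0 : 0 <= s < u by rewrite /s; apply/andP; split; lra.
  have usd : `|u - s| < d by rewrite /s opprB addrC subrK gtr0_norm//; lra.
  have := hd s usd j; rewrite ltr_norml => /andP[+ _].
  by have := below s s0 j; lra.
have mu j : m <= L u j.
  apply: good => // s /andP[s0]; rewrite le_eqVlt => /predU1P[->//|su] j'.
  by apply: below; rewrite s0.
(* Lengths at least [m] at [u] stay above [k] for a while, yet bad times accumulate at [u] from the
   right. *)
have [d d0 hd] := near_u (m - k) ltac:(by rewrite subr_gt0).
have [s [s0 [j Lsk]] su] := inf_adherent d0 (conj ne (ex_intro _ 0 lb0)).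
have us : u <= s by apply: ge_inf; [exists 0|split=> //; exists j].
have usd : `|u - s| < d by rewrite distrC ger0_norm ?subr_ge0// ltrBlDl.
by have := hd s usd j; rewrite ltr_norml => /andP[_]; have := mu j; lra.
Qed.

(** * Energy, speed and dissipation for lengths between two positive constants *)

Section Pinched.
Variables m M : R.
Hypotheses (m0 : 0 < m) (M0 : 0 < M).

(** For pinched lengths the energy dominates the squared deviation from [rho], and the speed is at
    most linear in that deviation. *)
Lemma energy_controls : exists2 C, 0 < C & forall L, (forall i, m <= L i <= M) ->
  (\sum_j `|L j - rho j|) ^+ 2 <= C * energy L /\
  forall i, flow_field L i ^+ 2 <= C * energy L.
Proof.
have [c c0 cw] := fin_lb R n w w0.
have [W W0 wW] := fin_ub R n w.
have [P P0 rP] := fin_ub R n rho.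
have [A A0 aA] := fin_ub R n (fun i => \sum_j `|a i j|).
pose C1 := (n%:R + 1) * (M / c).
have C10 : 0 < C1 by rewrite mulr_gt0 ?divr_gt0 ?ltr_wpDl.
pose B := W / m * (A * (W * ((M + P) / m ^+ 2))).
have B0 : 0 < B by rewrite !mulr_gt0 ?invr_gt0 ?exprn_gt0 ?addr_gt0.
pose C := C1 + B ^+ 2 * C1.
exists C => [|L mLM]; first by rewrite addr_gt0// mulr_gt0// exprn_gt0.
have L0 i : 0 < L i by have /andP[+ _] := mLM i; exact: lt_le_trans.
have E0 : 0 <= energy L.
  by apply: sumr_ge0 => j _; exact: (divr_ge0 (mulr_ge0 (ltW (w0 j)) (sqr_ge0 _)) (ltW (L0 j))).
set S := \sum_j `|L j - rho j|.
have S0 : 0 <= S by exact: sumr_ge0.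
have S2 : S ^+ 2 <= C1 * energy L.
  apply: le_trans (sum_norm_sqr_le R n _) _.
  rewrite /C1 -mulrA; apply: ler_pM => //.
  - by apply: sumr_ge0 => j _; exact: sqr_ge0.
  - by rewrite lerDl.
  rewrite /energy mulr_sumr; apply: ler_sum => j _.
  have /andP[mL LM] := mLM j.
  have q : 1 <= (M / c) * (w j / L j).
    rewrite mulrACA -invfM ler_pdivlMr ?mulr_gt0// mul1r mulrC.
    by apply: ler_pM => //; exact: ltW.
  rewrite (_ : M / c * _ = (M / c) * (w j / L j) * (L j - rho j) ^+ 2); last by ring.
  by rewrite ler_peMl// sqr_ge0.
split; first by rewrite (le_trans S2)// ler_wpM2r// lerDl mulr_ge0 ?sqr_ge0 ?(ltW C10).
move=> i; have fS : `|flow_field L i| <= B * S.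
  have zj j : `|grad L j| <= W * ((M + P) / m ^+ 2) * S.
    have /andP[mL LM] := mLM j.
    (* The factor [L j - rho j] shows that the gradient vanishes linearly at the equilibrium. *)
    rewrite (_ : grad L j = w j * ((L j + rho j) / L j ^+ 2) * (L j - rho j)); last first.
      by rewrite /grad; field; rewrite gt_eqF.
    rewrite normrM; apply: ler_pM => //.
      rewrite ger0_norm; last by rewrite mulr_ge0 ?divr_ge0 ?sqr_ge0 ?addr_ge0 ?ltW.
      apply: ler_pM => //; first exact: ltW.
        by rewrite divr_ge0 ?sqr_ge0 ?addr_ge0 ?ltW.
      apply: ler_pM; rewrite ?invr_ge0 ?sqr_ge0 ?addr_ge0 ?(ltW (L0 j)) ?(ltW (rho0 j))//.
        exact: lerD.
      by rewrite lef_pV2 ?posrE ?exprn_gt0// ler_sqr ?nnegrE ?(ltW m0) ?(ltW (L0 j)).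
    by rewrite /S (bigD1 j)//= lerDl sumr_ge0.
  rewrite /flow_field normrN normrM /B -[leRHS]mulrA; apply: ler_pM => //.
    rewrite ger0_norm; last exact: divr_ge0 (ltW (w0 i)) (ltW (L0 i)).
    apply: ler_pM; rewrite ?invr_ge0 ?(ltW (w0 i)) ?(ltW (L0 i))//.
    by rewrite lef_pV2 ?posrE//; have /andP[] := mLM i.
  rewrite /lin (le_trans (ler_norm_sum _ _ _))// -[leRHS]mulrA.
  apply: (@le_trans _ _ ((\sum_j `|a i j|) * (W * ((M + P) / m ^+ 2) * S))).
    rewrite mulr_suml; apply: ler_sum => j _; rewrite normrM ler_wpM2l//.
  by rewrite ler_wpM2r// (le_trans (normr_ge0 _) (zj i)).
rewrite -[flow_field L i ^+ 2]real_normK ?num_real//.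
apply: (@le_trans _ _ ((B * S) ^+ 2)).
  by rewrite ler_sqr ?nnegrE// (mulr_ge0 (ltW B0) S0).
rewrite exprMn /C mulrDl ler_wpDl//; first exact: mulr_ge0 (ltW C10) E0.
by rewrite -mulrA ler_wpM2l ?sqr_ge0.
Qed.

(** With S the sum of |A grad| and B that of |L - rho|, symmetry of the matrix gives energy <= K S
    B. Since S^2 is bounded by the dissipation and B^2 by the energy, squaring and cancelling one
    factor of the energy leaves a linear inequality. *)
Lemma energy_dissipation (K : R) : 0 <= K -> exists2 lambda, 0 < lambda &
  forall L y, (forall i, m <= L i <= M) -> (forall i, lin y i = L i - rho i) ->
    (forall i, `|y i| <= K * \sum_j `|L j - rho j|) ->
    lambda * energy L <= dissipation L.
Proof.
move=> K0; have [c c0 cw] := fin_lb R n w w0.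
have [C C0 EC] := energy_controls.
pose Q := K ^+ 2 * n%:R * (M / c) * C.
have Mc : 0 <= M / c := divr_ge0 (ltW M0) (ltW c0).
have Q0 : 0 <= Q := mulr_ge0 (mulr_ge0 (mulr_ge0 (sqr_ge0 K) (ler0n _ n)) Mc) (ltW C0).
(* The added 1 keeps the inverse meaningful when [Q] is 0, for instance when [K] is. *)
exists (Q + 1)^-1 => [|L y mLM yL yK]; first by rewrite invr_gt0 ltr_wpDl.
have L0 i : 0 < L i by have /andP[+ _] := mLM i; exact: lt_le_trans.
have D0 := dissipation_ge0 L L0.
rewrite ler_pdivrMl ?ltr_wpDl//.
suff QD : energy L <= Q * dissipation L by rewrite mulrDl mul1r ler_wpDr.
have [EL _] := EC L mLM.
set B := \sum_j `|L j - rho j| in yK EL.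
have B0 : 0 <= B by exact: sumr_ge0.
pose S := \sum_i `|lin (grad L) i|.
have S0 : 0 <= S by exact: sumr_ge0.
have E1 : energy L <= K * S * B.
  apply: (@le_trans _ _ (\sum_i grad L i * lin y i)).
    apply: ler_sum => i _; rewrite yL.
    have -> : grad L i * (L i - rho i) =
        w i * (L i - rho i) ^+ 2 / L i + w i * rho i * (L i - rho i) ^+ 2 / L i ^+ 2.
      by rewrite /grad; field; rewrite gt_eqF.
    by rewrite lerDl divr_ge0 ?sqr_ge0// mulr_ge0 ?sqr_ge0// mulr_ge0// ltW.
  rewrite lin_sym (_ : K * S * B = S * (K * B)); last by ring.
  rewrite mulr_suml; apply: ler_sum => i _.
  by rewrite (le_trans (ler_norm _))// normrM ler_wpM2l.
have S2 : S ^+ 2 <= n%:R * (M / c) * dissipation L.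
  apply: le_trans (sum_norm_sqr_le R n _) _.
  rewrite -mulrA ler_wpM2l// /dissipation mulr_sumr; apply: ler_sum => j _.
  have /andP[mL LM] := mLM j.
  rewrite mulrA ler_peMl ?sqr_ge0//.
  rewrite mulrACA -invfM ler_pdivlMr ?mulr_gt0// mul1r mulrC.
  by apply: ler_pM => //; exact: ltW.
have E0 : 0 <= energy L.
  by apply: sumr_ge0 => j _; exact: (divr_ge0 (mulr_ge0 (ltW (w0 j)) (sqr_ge0 _)) (ltW (L0 j))).
have [->|Ene0] := eqVneq (energy L) 0; first exact: mulr_ge0.
have Epos : 0 < energy L by rewrite lt_neqAle eq_sym Ene0.
rewrite -(ler_pM2r Epos) -expr2.
apply: (@le_trans _ _ ((K * S * B) ^+ 2)).
  by rewrite ler_sqr ?nnegrE// (le_trans E0 E1).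
have -> : (K * S * B) ^+ 2 = K ^+ 2 * (S ^+ 2 * B ^+ 2) by ring.
have -> : Q * dissipation L * energy L =
    K ^+ 2 * (n%:R * (M / c) * dissipation L * (C * energy L)) by rewrite /Q; ring.
by rewrite ler_wpM2l ?sqr_ge0// ler_pM ?sqr_ge0.
Qed.

End Pinched.

(** Time starts at 1 because a flow is differentiable only at positive times. The family [y]
    provides controlled preimages of [L - rho] under the matrix, as [energy_dissipation]
    requires. *)
Theorem flow_converges (L h y : R -> 'I_n -> R) (K : R) : 0 <= K ->
  (forall t : R, 1 <= t -> forall i, 0 < L t i) ->
  (forall t : R, 1 <= t -> forall i, is_derive t 1 (h^~ i) (flow_field (L t) i)) ->
  (forall t : R, 1 <= t -> forall i,
     is_derive t 1 (L^~ i) (lin (flow_field (L t)) i)) ->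
  (forall t : R, 1 <= t -> forall i, lin (y t) i = L t i - rho i) ->
  (forall t : R, 1 <= t -> forall i, `|y t i| <= K * \sum_j `|L t j - rho j|) ->
  (forall i, exists l : R, h t i @[t --> +oo] --> l) /\
  (forall i, L t i @[t --> +oo] --> rho i).
Proof.
move=> K0 L0 dh dL yL yK.
have [m [M [m0 M0 mM]]] := energy_sublevel (energy (L 1)).
have pinch (t : R) : 1 <= t -> forall i, m <= L t i <= M.
  move=> t1; apply: mM; first exact: L0.
  by apply: energy_le => // s /andP[s1 _]; [exact: L0|exact: dL].
have [C C0 EC] := energy_controls m M m0 M0.
have [lam lam0 Elam] := energy_dissipation m M m0 M0 K K0.
(* The factor [expR lam] comes from integrating the differential inequality from time 1 rather than
   0. *)
pose A := C * (energy (L 1) * expR lam).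
have E0 : 0 <= energy (L 1).
  by apply: sumr_ge0 => j _; exact: (divr_ge0 (mulr_ge0 (ltW (w0 j)) (sqr_ge0 _)) (ltW (L0 1 (lexx _) j))).
have A0 : 0 <= A by rewrite /A !mulr_ge0 ?expR_ge0 ?(ltW C0).
have decay (t : R) : 1 <= t -> C * energy (L t) <= A * expR (- (lam * t)).
  move=> t1; rewrite /A -!mulrA ler_pM2l// expRN mulrA ler_pdivlMr ?expR_gt0//.
  pose e (s : R) := expR (lam * s).
  have de (s : R) : is_derive s 1 e (e s * lam).
    have H1 : is_derive s 1 (fun r : R => lam * r) lam.
      have := is_deriveZ lam (is_derive_id s (1 : R)); rewrite scaler1; exact.
    exact (@is_derive1_comp R expR (fun r : R => lam * r) s _ _ (is_derive_expR (lam * s)) H1).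
  have : - (energy (L 1) * e 1) <= - (energy (L t) * e t).
    apply: (@ge0_derive_le R (fun s => - (energy (L s) * e s))
      (fun s => - (energy (L s) * (e s * lam) + e s * - dissipation (L s)))) => //.
      move=> s /andP[s1 _]; rewrite -sum_grad_flow_field.
      exact (is_deriveN (is_deriveM (is_derive_energy _ _ _ (L0 s s1) (dL s s1)) (de s))).
    move=> s /andP[s1 _].
    have := Elam (L s) (y s) (pinch s s1) (yL s s1) (yK s s1).
    have := expR_gt0 (lam * s); rewrite -/(e s).
    by nra.
  by rewrite lerN2 /e mulr1.
(* The energy controls squares, so the rate is halved. *)
have sq (t x : R) : 1 <= t -> x ^+ 2 <= C * energy (L t) ->
    `|x| <= Num.sqrt A * expR (- (lam / 2 * t)).
  move=> t1 h2; rewrite -ler_sqr ?nnegrE ?mulr_ge0 ?sqrtr_ge0 ?expR_ge0//.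
  rewrite real_normK ?num_real// (le_trans h2)// (le_trans (decay t t1))//.
  rewrite exprMn sqr_sqrtr// ler_wpM2l// expr2 -expRD ler_expR; lra.
have lam2 : 0 < lam / 2 by rewrite divr_gt0.
split=> i.
  apply: (exp_decay_cvg R (h^~ i) (fun t => flow_field (L t) i) (Num.sqrt A) (lam / 2)) => //.
    by move=> t t1; exact: dh.
  by move=> t t1; apply: sq => //; have [_] := EC (L t) (pinch t t1); exact.
have vl := cvg_expRN_mul R (Num.sqrt A) (lam / 2) lam2.
apply/cvgrPdist_le => e e0.
have /cvgrPdist_le/(_ e e0) := vl; apply: filter_app; near=> t.
have t1 : 1 <= t by [].
rewrite sub0r normrN => h2; rewrite distrC (le_trans _ (le_trans (ler_norm _) h2))//.
apply: (sq t) => //.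
have [+ _] := EC (L t) (pinch t t1); apply: le_trans.
rewrite -[(_ - _) ^+ 2]real_normK ?num_real// ler_sqr ?nnegrE ?sumr_ge0//.
by rewrite (bigD1 i)//= lerDl sumr_ge0.
Unshelve. all: by end_near. Qed.

End GradientFlow.

(** * Plane polygons with prescribed normals *)

Section PlaneAlgebra.
Variable R : realType.
Implicit Types (u v p q : plane R) (c : R).

Definition det2 u v : R := u 0 0 * v 0 1 - u 0 1 * v 0 0.

Lemma dotE u v : dot u v = u 0 0 * v 0 0 + u 0 1 * v 0 1.
Proof.
rewrite /dot big_ord_recl big_ord1; congr (_ + _ * _); congr (_ 0 _);
  exact: val_inj.
Qed.

Lemma planeP u v : u 0 0 = v 0 0 -> u 0 1 = v 0 1 -> u = v.
Proof.
move=> e0 e1; apply/rowP => -[[|[|//]] h].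
  by rewrite (_ : Ordinal h = 0)//; exact: val_inj.
by rewrite (_ : Ordinal h = 1)//; exact: val_inj.
Qed.

Lemma rot90E u : (rot90 u 0 0 = - u 0 1) * (rot90 u 0 1 = u 0 0).
Proof. by rewrite !mxE. Qed.

Lemma rot90_inj : injective (@rot90 R).
Proof.
move=> u v uv; apply: planeP.
  by have := congr1 (fun x : plane R => x 0 1) uv; rewrite !rot90E.
by have := congr1 (fun x : plane R => x 0 0) uv; rewrite !rot90E => /oppr_inj.
Qed.

Definition coordE := (dotE, rot90E, mxE).

Lemma dotC u v : dot u v = dot v u.
Proof. rewrite !dotE; ring. Qed.

Lemma dotBl u v p : dot (u - v) p = dot u p - dot v p.
Proof. rewrite !coordE; ring. Qed.

Lemma dotZl c u p : dot (c *: u) p = c * dot u p.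
Proof. rewrite !coordE; ring. Qed.

Lemma dot_ge0 u : 0 <= dot u u.
Proof. by rewrite dotE -!expr2 addr_ge0// sqr_ge0. Qed.

Lemma dot_eq0 u : (dot u u == 0) = (u == 0).
Proof.
rewrite dotE -!expr2 paddr_eq0 ?sqr_ge0// !sqrf_eq0.
apply/andP/eqP => [[/eqP u0 /eqP u1]|->]; last by rewrite !mxE.
by apply: planeP; rewrite mxE.
Qed.

Lemma enorm_gt0 u : (0 < enorm u) = (u != 0).
Proof. by rewrite sqrtr_gt0 lt_neqAle dot_ge0 andbT eq_sym dot_eq0. Qed.

Lemma enorm_sqr u : enorm u ^+ 2 = dot u u.
Proof. by rewrite sqr_sqrtr// dot_ge0. Qed.

Lemma enormZ c u : 0 <= c -> enorm (c *: u) = c * enorm u.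
Proof.
move=> c0; rewrite /enorm (_ : dot _ _ = c ^+ 2 * dot u u).
  by rewrite sqrtrM ?sqr_ge0// sqrtr_sqr ger0_norm.
by rewrite !coordE; ring.
Qed.

Lemma len_tangent (S : oseg R) : 0 < len S -> S.2 - S.1 = len S *: tangent S.
Proof. by move=> S0; rewrite scalerA divff ?scale1r// gt_eqF. Qed.

Lemma tangent_unit (S : oseg R) : 0 < len S -> dot (tangent S) (tangent S) = 1.
Proof.
move=> S0; rewrite -enorm_sqr enormZ ?invr_ge0 ?ltW//.
by rewrite mulVf ?expr1n// gt_eqF.
Qed.

Lemma lagrange u v : dot u v ^+ 2 + det2 u v ^+ 2 = dot u u * dot v v.
Proof. rewrite !dotE /det2; ring. Qed.

Lemma dot_rot90 u v : dot (rot90 u) v = det2 u v.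
Proof. rewrite !coordE /det2; ring. Qed.

Lemma dot_rot90r u v : dot u (rot90 v) = det2 v u.
Proof. rewrite !coordE /det2; ring. Qed.

Lemma det2C u v : det2 u v = - det2 v u.
Proof. rewrite /det2; ring. Qed.

Lemma unit_decomp q u : dot q q = 1 -> u = dot u q *: q + dot u (rot90 q) *: rot90 q.
Proof.
move=> q1; apply: planeP; rewrite !coordE in q1 *.
  by rewrite -[LHS]mulr1 -q1; ring.
by rewrite -[LHS]mulr1 -q1; ring.
Qed.

End PlaneAlgebra.
Arguments det2 {R} u v.

(** * Support numbers and signed side lengths of closed polygons *)

Section Frame.
Variables (R : realType) (n : nat) (tau : 'I_n -> plane R).
Implicit Types (x D : 'I_n -> R) (v : 'I_n -> plane R) (i j : 'I_n).

Lemma ordS_ind (P : 'I_n -> Prop) i0 :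
  P i0 -> (forall i, P i -> P (ordS i)) -> forall i, P i.
Proof.
move=> P0 PS i; have Pm m : P (iter m (@ordS n) i0).
  by elim: m => //= m; exact: PS.
(* That many steps lead from [i0] to i + n, which is [i] modulo n, without a negative difference. *)
suff -> : i = iter (i + (n - i0))%N (@ordS n) i0 by exact: Pm.
have val_iter m : iter m (@ordS n) i0 = ((i0 + m) %% n)%N :> nat.
  elim: m => [|m IH] /=; first by rewrite addn0 modn_small.
  by rewrite IH -addn1 modnDml addn1 addnS.
apply: val_inj; rewrite [RHS]val_iter addnCA subnKC; last exact: ltnW.
by rewrite modnDr modn_small.
Qed.

Hypothesis tau1 : forall i, dot (tau i) (tau i) = 1.
Hypothesis turn : forall i, det2 (tau (ord_pred i)) (tau i) != 0.

Local Notation N i := (rot90 (tau i)).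
Local Notation s i := (det2 (tau (ord_pred i)) (tau i)).
Local Notation k i := (dot (tau (ord_pred i)) (tau i)).

(* Maps the support numbers of a closed polygon with unit tangents tau to the
   signed lengths of its sides. *)
Definition side_mx i j : R :=
  - (s i)^-1 * (j == ord_pred i)%:R +
  (k i / s i + k (ordS i) / s (ordS i)) * (j == i)%:R -
  (s (ordS i))^-1 * (j == ordS i)%:R.

Lemma side_mx_sym i j : side_mx i j = side_mx j i.
Proof.
have e (i' j' : 'I_n) :
    (s i')^-1 * (j' == ord_pred i')%:R = (s (ordS j'))^-1 * (i' == ordS j')%:R.
  have [->|ne] := eqVneq i' (ordS j'); first by rewrite ordSK eqxx.
  rewrite (_ : (j' == _) = false) ?mulr0//.
  by apply/negP => /eqP e; move: ne; rewrite e ord_predK eqxx.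
rewrite /side_mx !mulNr !e (eq_sym i j).
by have [->|_] := eqVneq j i; [ring|rewrite !mulr0; ring].
Qed.

Lemma lin_side_mx x i : lin R n side_mx x i =
  - (x (ord_pred i) / s i) + (k i / s i + k (ordS i) / s (ordS i)) * x i
    - x (ordS i) / s (ordS i).
Proof.
have pick (c : R) (j0 : 'I_n) : \sum_j c * (j == j0)%:R * x j = c * x j0.
  rewrite (bigD1 j0)//= eqxx mulr1 big1 ?addr0// => j /negPf ->.
  by rewrite mulr0 mul0r.
rewrite /lin /side_mx.
under eq_bigr do rewrite mulrBl mulrDl.
by rewrite sumrB big_split/= !pick; ring.
Qed.

Lemma lin_side_mx_support v D : (forall i, v (ordS i) - v i = D i *: tau i) ->
  forall i, lin R n side_mx (fun j => dot (v j) (N j)) i = D i.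
Proof.
move=> vD i; rewrite lin_side_mx.
have e1 : v (ordS i) = v i + D i *: tau i by rewrite -vD addrC subrK.
have e0 : v i = v (ord_pred i) + D (ord_pred i) *: tau (ord_pred i).
  by rewrite -vD ord_predK addrC subrK.
(* The previous support number can be read off at [v i], which lies on the same line. *)
have -> : dot (v (ord_pred i)) (N (ord_pred i)) = det2 (tau (ord_pred i)) (v i).
  by rewrite e0 !coordE /det2 !mxE; ring.
rewrite e1.
have si := turn i; have sS := turn (ordS i); rewrite ordSK in sS.
rewrite ordSK.
move: (tau (ord_pred i)) (tau i) (tau (ordS i)) (tau1 i) si sS (v i) (D i).
move=> p q r q1 si sS u d.
have A : det2 p u = dot p q * det2 q u + det2 p q * dot q u.
  by rewrite -[LHS]mulr1 -q1 !dotE /det2; ring.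
have B : det2 r u = dot q r * det2 q u - det2 q r * dot q u.
  by rewrite -[LHS]mulr1 -q1 !dotE /det2; ring.
have C : det2 r (u + d *: q) = det2 r u - d * det2 q r.
  by rewrite /det2 !mxE; ring.
rewrite !dot_rot90r C A B; by field; rewrite sS si.
Qed.

(** Consecutive support lines are not parallel, so the vertices are their intersections. The signed
    side lengths may be nonpositive. *)
Lemma side_mx_vertices x : exists v : 'I_n -> plane R, forall i,
  dot (v i) (N i) = x i /\ v (ordS i) - v i = lin R n side_mx x i *: tau i.
Proof.
(* The tangential coefficient solves the condition that [v i] also lies on the support line of the
   preceding side. *)
pose v i : plane R := x i *: N i + ((x (ord_pred i) - k i * x i) / s i) *: tau i.
exists v => i; split.
  have q1 := tau1 i.
  by rewrite -[RHS]mulr1 -q1 /v; move: (_ / s i) => z; rewrite !coordE; ring.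
rewrite lin_side_mx /v ordSK.
have si := turn i; have sS := turn (ordS i); rewrite ordSK in sS.
move: (tau (ord_pred i)) (tau i) (tau (ordS i)) (tau1 i) (tau1 (ordS i)) si sS.
move: (x (ord_pred i)) (x i) (x (ordS i)) => a b c p q r q1 r1 si sS.
have rq : r = dot q r *: q + det2 q r *: rot90 q.
  by rewrite {1}(unit_decomp R q r q1) dot_rot90r dotC.
have rr : rot90 r = dot q r *: rot90 q - det2 q r *: q.
  by rewrite [in LHS]rq; apply: planeP; rewrite !coordE; ring.
have kap : dot q r ^+ 2 + det2 q r ^+ 2 = 1 by rewrite lagrange q1 r1 mulr1.
have -> : c / det2 q r = c * (dot q r ^+ 2 + det2 q r ^+ 2) / det2 q r.
  by rewrite kap mulr1.
rewrite rr [X in _ + _ *: X - _]rq.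
move: (dot q r) (det2 q r) (dot p q) (det2 p q) sS si => kr sr kp sp sr0 sp0.
by apply: planeP; rewrite !coordE; field; rewrite sr0 sp0.
Qed.

(** The matrix kills translations, so support numbers are bounded by side lengths only relative to a
    fixed vertex. Walking along the cycle from it, each side adds at most |D_j| to either
    coordinate. *)
Lemma vertex_spread i0 : exists2 K : R, 0 <= K & forall v D,
  (forall i, v (ordS i) - v i = D i *: tau i) ->
  forall i, `|dot (v i - v i0) (N i)| <= K * \sum_j `|D j|.
Proof.
have tau_le i (c : 'I_2) : `|tau i 0 c| <= 1.
  have sq : tau i 0 c ^+ 2 <= dot (tau i) (tau i).
    by rewrite /dot (bigD1 c)//= -expr2 lerDl sumr_ge0// => j _; rewrite -expr2 sqr_ge0.
  by rewrite -(@ler_pXn2r _ 2)// ?nnegrE// real_normK ?num_real// expr1n -(tau1 i).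
have P i : exists2 K : R, 0 <= K & forall v D,
    (forall i, v (ordS i) - v i = D i *: tau i) ->
    forall c : 'I_2, `|v i 0 c - v i0 0 c| <= K * \sum_j `|D j|.
  apply: (ordS_ind (fun i => _) i0) i => [|i [K K0 hK]].
    by exists 0 => // v D _ c; rewrite subrr normr0 mul0r.
  exists (K + 1) => [|v D vD c]; first exact: addr_ge0.
  have -> : v (ordS i) 0 c - v i0 0 c = (v i 0 c - v i0 0 c) + D i * tau i 0 c.
    have := congr1 (fun u : plane R => u 0 c) (vD i).
    by rewrite !mxE => <-; ring.
  rewrite mulrDl (le_trans (ler_normD _ _))// lerD//; first exact: hK.
  rewrite normrM mul1r (le_trans (ler_piMr _ (tau_le i c)))//.
  by rewrite (bigD1 i)//= lerDl sumr_ge0.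
have : forall i, exists K : R, 0 <= K /\ forall v D,
    (forall i, v (ordS i) - v i = D i *: tau i) ->
    forall c : 'I_2, `|v i 0 c - v i0 0 c| <= K * \sum_j `|D j|.
  by move=> i; have [K K0 hK] := P i; exists K.
move=> /choice[K KP].
have [C C0 KC] := fin_ub R n K.
exists (C + C) => [|v D vD i]; first by rewrite addr_ge0// ltW.
have S0 : 0 <= \sum_j `|D j| by exact: sumr_ge0.
have b c c' : `|(v i - v i0) 0 c * tau i 0 c'| <= C * \sum_j `|D j|.
  rewrite normrM (le_trans (ler_piMr _ (tau_le i c')))// !mxE.
  by rewrite (le_trans ((KP i).2 v D vD c))// ler_wpM2r.
rewrite dot_rot90r /det2 mulrDl (le_trans (ler_normB _ _))// lerD//; rewrite mulrC; exact: b.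
Qed.

End Frame.

(** * Angles and facets *)

Section Angles.
Variables (R : realType) (n : nat) (v : 'I_n -> plane R).
Hypothesis v_closed : closed_polygonal v.

Local Notation p i := (tangent (side v (ord_pred i))).
Local Notation q i := (tangent (side v i)).

Let len0 i : 0 < len (side v i).
Proof. by have [_ + _] := v_closed. Qed.

Lemma turn_unit i : dot (p i) (q i) ^+ 2 + det2 (p i) (q i) ^+ 2 = 1.
Proof. by rewrite lagrange !tangent_unit// mulr1. Qed.

Lemma inner_normalsE i : inner_normals v i = (0 <= det2 (p i) (q i)).
Proof.
rewrite /inner_normals /normal !dot_rot90r.
have -> : det2 (q i) (- p i) = det2 (p i) (q i) by rewrite /det2 !mxE; ring.
by rewrite andbb.
Qed.

Lemma cone_angle_itv i : -1 <= dot (- p i) (q i) <= 1.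
Proof.
have -> : dot (- p i) (q i) = - dot (p i) (q i) by rewrite !coordE; ring.
have h : dot (p i) (q i) ^+ 2 <= 1 by rewrite -(turn_unit i) lerDl sqr_ge0.
by rewrite -ler_norml normrN -(@ler_pXn2r _ 2)// ?nnegrE// real_normK ?num_real// expr1n.
Qed.

(** As acos never exceeds pi, such an angle is 2 pi minus the cone angle. Its sine and cosine become
    polynomial in the unit tangents, which makes the velocity an algebraic expression. *)
Lemma clockwise_turn i : pi < theta v i ->
  [/\ det2 (p i) (q i) < 0, sin (theta v i) = det2 (p i) (q i) &
      cos (theta v i) = - dot (p i) (q i)].
Proof.
have itv := cone_angle_itv i.
rewrite /theta inner_normalsE; case: ifPn => [_|].
  by rewrite /cone_angle ltNge acos_lepi.
rewrite -ltNge => s0 _; split=> //.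
  rewrite addrC mulr_natl sinD2pi sinN /cone_angle sin_acos//.
  have -> : 1 - dot (- p i) (q i) ^+ 2 = (- det2 (p i) (q i)) ^+ 2.
    rewrite -(turn_unit i) (_ : dot (- p i) (q i) = - dot (p i) (q i)); first by ring.
    by rewrite !coordE; ring.
  by rewrite sqrtr_sqr gtr0_norm ?oppr_gt0// opprK.
rewrite addrC mulr_natl cosD2pi cosN /cone_angle acosK ?in_itv//.
by rewrite !coordE; ring.
Qed.

(** A nonzero transition number puts two consecutive angles on the same side of pi, hence all of
    them; if all were below pi, the sum in [clockwise] would be nonnegative. *)
Lemma convex_clockwise_transition : convex_curve v -> clockwise v ->
  forall i, pi < theta v i /\ transition v i = 1.
Proof.
move=> cv cw.
have [n0 _ _] := v_closed.
have tr i : (pi < theta v i /\ pi < theta v (ordS i) /\ transition v i = 1) \/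
    (theta v i < pi /\ theta v (ordS i) < pi).
  have := cv i; rewrite /transition; case: ifP => [/andP[/andP[h1 _] /andP[h2 _]] _|_].
    by left.
  case: ifP => [/andP[/andP[_ h1] /andP[_ h2]] _|_]; first by right.
  by rewrite eqxx.
suff big i : pi < theta v i.
  move=> i; split => //; have [[_ [_ //]]|[h _]] := tr i.
  by have := lt_trans h (big i); rewrite ltxx.
move: i; pose i0 := Ordinal n0.
case: (ltP pi (theta v i0)) => h0.
  apply: (ordS_ind n (fun i => pi < theta v i) i0 h0) => i hi.
  have [[_ [//]]|[h _]] := tr i.
  by have := lt_trans h hi; rewrite ltxx.
have h1 : theta v i0 < pi by have [[h _]|[//]] := tr i0; move: h; rewrite ltNge h0.
have small : forall i, theta v i < pi.
  apply: (ordS_ind n (fun i => theta v i < pi) i0 h1) => i hi.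
  have [[h _]|[_ //]] := tr i.
  by have := lt_trans h hi; rewrite ltxx.
move: cw; rewrite /clockwise ltNge sumr_ge0// => i _.
by rewrite subr_ge0 ltW.
Qed.

End Angles.

(** * Anisotropies, Wulff shapes and their facets *)

Section WulffShape.
Variables (R : realType) (phi : plane R -> R).
Hypothesis phi_aniso : anisotropy phi.
Implicit Types (x y : plane R) (F : oseg R).

Lemma aniso_scale (l : R) x : 0 < l -> phi (l *: x) = l * phi x.
Proof. by have [_ + _ _] := phi_aniso; apply. Qed.

Lemma aniso_upper : exists2 C : R, 0 < C & forall x, phi x <= C * enorm x.
Proof.
have [_ _ _ [c [C [c0 cC]]]] := phi_aniso.
exists (Num.max C 1) => [|x]; first by rewrite lt_max ltr01 orbT.
have /andP[_ h] := cC x; rewrite (le_trans h)// ler_wpM2r ?sqrtr_ge0//.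
by rewrite le_max lexx.
Qed.

Lemma aniso0 : phi 0 = 0.
Proof.
have [_ _ p0 [c [C [c0 /(_ 0)/andP[_ h]]]]] := phi_aniso.
apply/eqP; rewrite eq_le p0 andbT (le_trans h)//.
by rewrite /enorm (_ : dot 0 0 = 0) ?sqrtr0 ?mulr0//; apply/eqP; rewrite dot_eq0.
Qed.

(** Convexity at the midpoint, rescaled by homogeneity. *)
Lemma anisoD x y : phi (x + y) <= phi x + phi y.
Proof.
have [cv _ _ _] := phi_aniso.
have h0 : 0 <= 2^-1 :> R by [].
have h1 : 2^-1 <= 1 :> R by rewrite invf_le1 ?ler1n.
have := cv (Itv01 h0 h1) x y; rewrite !inE => /(_ I I).
have half : unstable.onem (2^-1 : R) = 2^-1 by rewrite /unstable.onem; field.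
rewrite convRE /conv/= half -scalerDr aniso_scale ?invr_gt0// -mulrDr.
by rewrite ler_pM2l ?invr_gt0.
Qed.

Lemma enorm_le x (d : R) : (forall c : 'I_2, `|x 0 c| <= d) -> enorm x <= 2 * d.
Proof.
move=> xd; have d0 : 0 <= d by exact: le_trans (normr_ge0 _) (xd 0).
rewrite -ler_sqr ?nnegrE ?sqrtr_ge0 ?mulr_ge0// enorm_sqr dotE -!expr2.
have sq c : x 0 c ^+ 2 <= d ^+ 2.
  by rewrite -[x 0 c ^+ 2]real_normK ?num_real// ler_sqr ?nnegrE.
by have := sq 0; have := sq 1; have := sqr_ge0 d; lra.
Qed.

(** Subadditivity bounds the increment by [phi (x - y)] or [phi (y - x)]; both occur, since [phi]
    may fail to be even. *)
Lemma aniso_continuous p : continuous (fun x : plane R => phi (x - p)).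
Proof.
have [C C0 hC] := aniso_upper.
move=> x; apply/(@cvgrPdist_le _ _ _ (nbhs x) (nbhs_filter x)) => e e0.
have d0 : 0 < e / (2 * C) by rewrite divr_gt0// mulr_gt0.
apply/nbhs_ballP; exists (e / (2 * C)) => // y xy.
have bound (u : plane R) : (forall c : 'I_2, `|u 0 c| <= e / (2 * C)) -> phi u <= e.
  move=> /enorm_le hu; rewrite (le_trans (hC u))//.
  have E : 2 * (e / (2 * C)) = C^-1 * e by field; rewrite gt_eqF.
  by rewrite -ler_pdivlMl// -E.
have xyc (c : 'I_2) : `|x 0 c - y 0 c| <= e / (2 * C).
  by case: xy => _ xy; exact: ltW (xy 0 c).
have h1 : phi (x - y) <= e by apply: bound => c; rewrite !mxE.
have h2 : phi (y - x) <= e.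
  by apply: bound => c; rewrite !mxE distrC.
have := anisoD (y - p) (x - y); have := anisoD (x - p) (y - x).
rewrite ![(_ - p) + _]addrC !addrA !subrK => h3 h4.
by rewrite ler_norml; apply/andP; split; lra.
Qed.

Lemma boundary_wulff (r : R) p : 0 < r ->
  boundary (wulff phi r p) = [set x | phi (x - p) = r].
Proof.
move=> r0; have cphi := aniso_continuous p.
have cl : closure (wulff phi r p) = wulff phi r p.
  apply/esym/closure_id.
  apply: (@closed_comp _ _ (fun x : plane R => phi (x - p)) [set y | y <= r]).
    by move=> x _; exact: cphi.
  exact: closed_le.
rewrite /boundary cl; apply/seteqP; split => x /=.
  move=> [xr nx]; apply/eqP; rewrite eq_le xr/= leNgt; apply/negP => lt.
  apply: nx; rewrite /interior.
  have o : open [set y : plane R | phi (y - p) < r].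
    apply: (@open_comp _ _ (fun x : plane R => phi (x - p)) [set y | y < r]).
      by move=> y _; exact: cphi.
    exact: open_lt.
  apply: filterS (open_nbhs_nbhs (conj o lt)) => y; exact: ltW.
move=> xr; split; first by rewrite /wulff/= xr.
rewrite /interior => /nbhs_ballP[d d0 hd].
pose B := `|(x - p) 0 0| + `|(x - p) 0 1| + 1.
have B0 : 0 < B by rewrite ltr_wpDl// addr_ge0.
have Bc (c : 'I_2) : `|(x - p) 0 c| < B.
  have [->|->] : c = 0 \/ c = 1.
  - by case: c => -[|[|//]] h; [left|right]; exact: val_inj.
  - by rewrite /B -addrA ltrDl ltr_wpDl.
  - by rewrite /B addrAC ltrDr ltr_wpDl.
(* Stretching [x - p] by 1 + e moves every coordinate by less than [d], yet raises [phi] above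
   [r]. *)
pose e := d / B; have e0 : 0 < e by exact: divr_gt0.
have /hd : ball x d (x + e *: (x - p)).
  split=> // i c; rewrite (ord1 i) /ball/= !mxE opprD addrA subrr sub0r normrN normrM.
  rewrite gtr0_norm// /e mulrAC ltr_pdivrMr// ltr_pM2l//.
  by have := Bc c; rewrite !mxE.
rewrite /wulff/= addrAC (_ : _ + e *: _ = (1 + e) *: (x - p)); last first.
  by rewrite scalerDl scale1r.
rewrite aniso_scale ?addr_gt0// xr.
by rewrite leNgt mulrDl mul1r ltrDl mulr_gt0.
Qed.

Lemma facet_ends F : is_facet (unit_wulff phi) F ->
  [/\ 0 < len F, unit_wulff phi F.1 & unit_wulff phi F.2].
Proof.
move=> [F12 _ W]; split; first by rewrite enorm_gt0 subr_eq0 eq_sym.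
  have : segment F F.1.
    by exists 0; [rewrite /= in_itv/= lexx ler01|rewrite subr0 scale1r scale0r addr0].
  by rewrite -W => -[].
have : segment F F.2.
  by exists 1; [rewrite /= in_itv/= lexx ler01|rewrite subrr scale1r scale0r add0r].
by rewrite -W => -[].
Qed.

Lemma dual_facet F : is_facet (unit_wulff phi) F ->
  dual phi (normal F) = dot F.1 (normal F).
Proof.
move=> hF; have [_ W1 _] := facet_ends F hF; have [_ sup _] := hF.
have ub : ubound [set dot (normal F) y | y in unit_wulff phi] (dot F.1 (normal F)).
  by move=> _ [y Wy <-]; rewrite dotC; exact: sup.
have mem : [set dot (normal F) y | y in unit_wulff phi] (dot F.1 (normal F)).
  by exists F.1 => //; rewrite dotC.
apply/eqP; rewrite eq_le; apply/andP; split.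
  by apply: ge_sup => //; exists (dot F.1 (normal F)).
by apply: ub_le_sup => //; exists (dot F.1 (normal F)).
Qed.

(** The Wulff shape contains the ball of radius 1 / C around the origin, so every supporting line
    keeps at least that distance. *)
Lemma dual_facet_gt0 F : is_facet (unit_wulff phi) F -> 0 < dot F.1 (normal F).
Proof.
move=> hF; have [l0 _ _] := facet_ends F hF; have [_ sup _] := hF.
have N1 : dot (normal F) (normal F) = 1.
  by rewrite -(tangent_unit R F l0) /normal !coordE; ring.
have [C C0 hC] := aniso_upper.
have C1 : 0 < C^-1 by rewrite invr_gt0.
have WN : unit_wulff phi (C^-1 *: normal F).
  rewrite /unit_wulff/= aniso_scale// ler_pdivrMl// mulr1.
  by rewrite (le_trans (hC _))// /enorm N1 sqrtr1 mulr1.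
by apply: lt_le_trans (sup _ WN); rewrite dotZl N1 mulr1.
Qed.

Lemma facet_phi F x : is_facet (unit_wulff phi) F -> segment F x -> phi x = 1.
Proof.
move=> hF; have w0 := dual_facet_gt0 F hF; have [_ sup W] := hF.
rewrite -W => -[/= x1 xN]; apply/eqP; rewrite eq_le x1/= leNgt; apply/negP => lt1.
have [_ _ p0 _] := phi_aniso.
have q0 : 0 < 1 + phi x by rewrite ltr_pwDl.
(* If [phi x < 1], this factor exceeds 1 and still keeps [l *: x] in the Wulff shape, which places
   it beyond the supporting line. *)
pose l := 2 / (1 + phi x).
have l0 : 0 < l by rewrite divr_gt0.
have l1 : 1 < l by rewrite ltr_pdivlMr// mul1r; lra.
have := sup (l *: x); rewrite /unit_wulff/= aniso_scale// dotZl xN.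
have -> : l * phi x <= 1 by rewrite /l mulrAC ler_pdivrMr// mul1r; lra.
by move=> /(_ isT); rewrite leNgt -[ltLHS]mul1r ltr_pM2r// l1.
Qed.

(** A right turn puts [p.1] strictly inside the supporting line of [q], and [q.2] strictly inside
    that of [p]; this excludes the other three coincidences of endpoints. *)
Lemma facets_join (p q : oseg R) : is_facet (unit_wulff phi) p ->
  is_facet (unit_wulff phi) q -> common_vertex p q ->
  det2 (tangent p) (tangent q) < 0 -> p.2 = q.1.
Proof.
move=> hp hq cv turn.
have [lp p1 p2] := facet_ends p hp; have [lq q1 q2] := facet_ends q hq.
have [_ sp _] := hp; have [_ sq _] := hq.
have ep := len_tangent R p lp; have eq := len_tangent R q lq.
have Ap : dot (p.2 - p.1) (normal q) > 0.
  by rewrite ep dotZl /normal dot_rot90r mulr_gt0// det2C oppr_gt0.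
have Aq : dot (q.2 - q.1) (normal p) < 0.
  by rewrite eq dotZl /normal dot_rot90r pmulr_rlt0.
have Bq : dot q.2 (normal q) = dot q.1 (normal q).
  apply/eqP; rewrite -subr_eq0 -dotBl eq dotZl /normal dot_rot90r /det2.
  by apply/eqP; ring.
have Bp : dot p.2 (normal p) = dot p.1 (normal p).
  apply/eqP; rewrite -subr_eq0 -dotBl ep dotZl /normal dot_rot90r /det2.
  by apply/eqP; ring.
rewrite !dotBl in Ap Aq.
have h1 := sq _ p2; have h2 := sp _ q1.
clear ep eq; case: cv => // e; exfalso; first by move: Ap h1; rewrite {}e; lra.
  by move: Ap h1; rewrite {}e; lra.
by move: Aq h2; rewrite -{}e Bp; lra.
Qed.

End WulffShape.

(** * Cones over the sides of a clockwise polygon *)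

Section Cover.
Variables (R : realType) (n : nat) (f : 'I_n -> plane R) (i0 : 'I_n).
Hypothesis turn : forall i, det2 (f i) (f (ordS i)) < 0.

(* If no cone contains x, then det2 x (f i) has a constant strict sign, so the
   cotangent of the angle from x to f i is strictly monotone along the cycle. *)
Lemma clockwise_cones_cover (x : plane R) : x != 0 ->
  exists i (a b : R), [/\ 0 <= a, 0 <= b & x = a *: f i + b *: f (ordS i)].
Proof.
move=> x0; pose d i := det2 x (f i).
(* Where [d] passes from nonnegative to nonpositive, Cramer's rule gives nonnegative
   coefficients. *)
have [[i [di dS]]|none] := pselect (exists i, 0 <= d i /\ d (ordS i) <= 0).
  have t0 : det2 (f i) (f (ordS i)) != 0 by rewrite lt_eqF.
  exists i, (d (ordS i) / det2 (f i) (f (ordS i))), (- d i / det2 (f i) (f (ordS i))).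
  have ti : (det2 (f i) (f (ordS i)))^-1 <= 0 by rewrite invr_le0 ltW.
  split; [exact: mulr_le0|by apply: mulr_le0 => //; rewrite oppr_le0|].
  have coord c : x 0 c * det2 (f i) (f (ordS i)) =
      d (ordS i) * f i 0 c - d i * f (ordS i) 0 c ->
      x 0 c = (d (ordS i) / det2 (f i) (f (ordS i)) *: f i
        + (- d i / det2 (f i) (f (ordS i))) *: f (ordS i)) 0 c.
    by move=> e; rewrite -[LHS](mulfK t0) e !mxE; field.
  by apply: planeP; apply: coord; rewrite /d /det2; ring.
have S i : 0 <= d i -> 0 < d (ordS i).
  by move=> di; rewrite ltNge; apply/negP => dS; apply: none; exists i.
have same i : 0 < d i * d (ordS i).
  have [[i1 d1]|neg] := pselect (exists i, 0 <= d i).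
    have pos : forall i, 0 < d i.
      apply: (ordS_ind n (fun i => 0 < d i) (ordS i1) (S _ d1)) => j /ltW; exact: S.
    exact: mulr_gt0.
  have {}neg j : d j < 0 by rewrite ltNge; apply/negP => dj; apply: neg; exists j.
  by rewrite nmulr_rgt0.
pose g i := dot x (f i) / d i.
have step i : 0 < g (ordS i) - g i.
  have nz : d i * d (ordS i) != 0 by rewrite gt_eqF.
  have [d1 d2] : d i != 0 /\ d (ordS i) != 0 by move: nz; rewrite mulf_eq0 negb_or => /andP.
  have -> : g (ordS i) - g i =
      - det2 (f i) (f (ordS i)) * dot x x / (d i * d (ordS i)).
    rewrite /g; apply/eqP; rewrite -subr_eq0; apply/eqP.
    rewrite [LHS](_ : _ = (dot x (f (ordS i)) * d i - dot x (f i) * d (ordS i)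
      + det2 (f i) (f (ordS i)) * dot x x) / (d i * d (ordS i))); last first.
      by field; rewrite d1 d2.
    rewrite (_ : _ + _ = 0) ?mul0r//.
    by rewrite /d !dotE /det2; ring.
  rewrite divr_gt0// mulr_gt0 ?oppr_gt0// lt_neqAle dot_ge0 andbT eq_sym.
  by rewrite dot_eq0.
have : 0 < \sum_i (g (ordS i) - g i).
  rewrite (bigD1 i0)//= ltr_pwDl// sumr_ge0// => j _; exact: ltW.
rewrite sumrB [X in X - _](_ : _ = \sum_i g i) ?subrr ?ltxx//.
by rewrite [RHS](reindex (@ordS n))//; exact: onW_bij (ordS_bij n).
Qed.

End Cover.

(** * Kuratowski limits of traces *)

Section KuratowskiTraces.
Variables (R : realType) (n : nat).
Implicit Types (v : 'I_n -> plane R).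

Lemma plane_ball (x y : plane R) (d : R) : 0 < d ->
  (forall c, `|x 0 c - y 0 c| < d) -> ball x d y.
Proof. by move=> d0 xy; split=> // i c; rewrite (ord1 i); exact: xy. Qed.

Lemma segment_closed (S : oseg R) : closed (segment S).
Proof.
apply: compact_closed; first exact: norm_hausdorff.
apply: continuous_compact; last exact: segment_compact.
apply: continuous_subspaceT => s.
by apply: cvgD; apply: cvgZr_tmp; [apply: cvgB; [exact: cvg_cst|exact: cvg_id]|exact: cvg_id].
Qed.

Lemma trace_closed v : closed (trace v).
Proof.
apply: closed_bigcup => [|i _]; first exact: finite_finset.
exact: segment_closed.
Qed.

(** Points with equal parameter on corresponding sides are as close as the vertices, uniformly in
    the parameter; closedness of the limit trace then excludes further limit points. *)
Lemma trace_kuratowski (G : R -> 'I_n -> plane R) v :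
  (forall i c, G t i 0 c @[t --> +oo] --> v i 0 c) ->
  kuratowski_cvg (fun t => trace (G t)) (trace v).
Proof.
move=> Gv.
have close (e : R) : 0 < e ->
    \forall t \near +oo, forall i c, `|v i 0 c - G t i 0 c| < e.
  move=> e0; apply: filter_forall => i; apply: filter_forall => c.
  by have /cvgrPdist_lt := Gv i c; apply.
have comb (u u' : 'I_n -> plane R) (e s : R) i : 0 <= s <= 1 ->
    (forall i c, `|u i 0 c - u' i 0 c| < e) -> forall c,
    `|((1 - s) *: u i + s *: u (ordS i)) 0 c -
      ((1 - s) *: u' i + s *: u' (ordS i)) 0 c| < e.
  move=> /andP[s0 s1] h c; rewrite !mxE.
  have h1 := h i c; have h2 := h (ordS i) c.
  rewrite (_ : _ - _ = (1 - s) * (u i 0 c - u' i 0 c)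
    + s * (u (ordS i) 0 c - u' (ordS i) 0 c)); last by ring.
  have s1' : 0 <= 1 - s by rewrite subr_ge0.
  apply: le_lt_trans (ler_normD _ _) _; rewrite !normrM (ger0_norm s0) (ger0_norm s1').
  (* Passing through the maximum keeps the inequality strict when one of the weights is 0. *)
  move: h1 h2; set A := `|_|; set B := `|_| => h1 h2.
  have m1 : A <= Num.max A B by rewrite le_max lexx.
  have m2 : B <= Num.max A B by rewrite le_max lexx orbT.
  have me : Num.max A B < e by rewrite gt_max h1.
  move: (Num.max A B) m1 m2 me => m m1 m2 me.
  have p1 : 0 <= (1 - s) * (m - A) by rewrite mulr_ge0// subr_ge0.
  have p2 : 0 <= s * (m - B) by rewrite mulr_ge0// subr_ge0.
  by lra.
have sup_sub : kuratowski_limsup (fun t => trace (G t)) `<=` trace v.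
  move=> x xs; apply: contrapT => nx.
  have /nbhs_ballP[d /= d0 hd] : nbhs x (~` trace v).
    by apply: open_nbhs_nbhs; split => //; apply: closed_openC; exact: trace_closed.
  have d20 : 0 < d / 2 by rewrite divr_gt0.
  have [M [_ hM]] := close _ d20.
  have [t Mt [y [[i _ [s /= s01 ys]] xy]]] := xs _ (nbhsx_ballx x (d / 2) d20) M.
  apply: (hd ((1 - s) *: v i + s *: v (ordS i))); last by exists i => //; exists s.
  apply: plane_ball => // c.
  have h1 := comb v (G t) (d / 2) s i; rewrite in_itv/= in s01.
  have /= ys' := ys; have := h1 s01 (hM t Mt) c; rewrite ys'.
  case: xy => _ /(_ 0 c); rewrite /ball/= => h2 h3.
  move: h2 h3; rewrite !ltr_norml => /andP[? ?] /andP[? ?].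
  by apply/andP; split; lra.
have sub_inf : trace v `<=` kuratowski_liminf (fun t => trace (G t)).
  move=> x [i _ [s /= s01 <-]] U /nbhs_ballP[d /= d0 hd].
  rewrite in_itv/= in s01.
  apply: filterS (close d d0) => t ht.
  exists ((1 - s) *: G t i + s *: G t (ordS i)); split; last first.
    by apply: hd; apply: plane_ball => // c; exact: comb s01 ht c.
  by exists i => //; exists s; rewrite /= ?in_itv.
have inf_sup : kuratowski_liminf (fun t => trace (G t)) `<=`
    kuratowski_limsup (fun t => trace (G t)).
  move=> x xi U Ux M.
  have [N [_ hN]] := xi U Ux.
  exists (Num.max N M + 1); first by rewrite ltr_pwDr// le_max lexx orbT.
  by apply: hN; rewrite ltr_pwDr// le_max lexx.
split; apply/seteqP; split => //.
- exact: subset_trans inf_sup sup_sub.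
- exact: subset_trans sub_inf inf_sup.
Qed.

End KuratowskiTraces.

(** * The facet polygon is the boundary of the Wulff shape *)

Section WulffPolygon.
Variables (R : realType) (phi : plane R -> R) (n : nat) (F : 'I_n -> oseg R).
Hypothesis phi_aniso : anisotropy phi.
Hypothesis F_facet : forall i, is_facet (unit_wulff phi) (F i).
Hypothesis F_join : forall i, (F i).2 = (F (ordS i)).1.

(** On facets [phi] is 1, which gives one inclusion by scaling. Conversely [x - p] lies in the cone
    over some facet; normalising its coefficients by their sum lands on that facet, so the sum is
    [r]. *)
Lemma trace_facets (i0 : 'I_n) (r : R) (p : plane R) : 0 < r ->
  trace (fun i => p + r *: (F i).1) = boundary (wulff phi r p).
Proof.
move=> r0; rewrite (boundary_wulff R phi)//.
have len0 i : 0 < len (F i) by have [] := facet_ends R phi (F i) (F_facet i).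
(* The determinant is minus the facet length times the distance of its line from the origin. *)
have turn i : det2 (F i).1 (F (ordS i)).1 < 0.
  rewrite -F_join -[(F i).2](subrK (F i).1) len_tangent//.
  have -> : det2 (F i).1 (len (F i) *: tangent (F i) + (F i).1) =
      - (len (F i) * dot (F i).1 (normal (F i))).
    by rewrite /normal dot_rot90r /det2 !mxE; ring.
  by rewrite oppr_lt0 mulr_gt0// (dual_facet_gt0 R phi).
have on_facet i (s : R) : 0 <= s <= 1 ->
    phi ((1 - s) *: (F i).1 + s *: (F (ordS i)).1) = 1.
  move=> s01; apply: (facet_phi R phi phi_aniso (F i)) => //.
  by exists s; rewrite /= ?in_itv ?F_join.
apply/seteqP; split => x /=.
  move=> [i _ [s /= s01 <-]]; rewrite in_itv/= in s01.
  rewrite (_ : _ - p = r *: ((1 - s) *: (F i).1 + s *: (F (ordS i)).1)).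
    by rewrite (aniso_scale R phi)// on_facet// mulr1.
  by apply: planeP; rewrite !mxE; ring.
move=> xr.
have xp0 : x - p != 0.
  apply/eqP => e; move: r0; rewrite -xr e (aniso0 R phi)// ltxx//.
have [i [a [b [a0 b0 xab]]]] :=
  clockwise_cones_cover R n (fun i => (F i).1) i0 turn (x - p) xp0.
have ab0 : 0 < a + b.
  rewrite lt_neqAle addr_ge0// andbT; apply: contra xp0 => /eqP.
  move/esym/eqP; rewrite paddr_eq0// => /andP[/eqP az /eqP bz].
  by rewrite xab az bz !scale0r addr0.
have itv : 0 <= b / (a + b) <= 1.
  by rewrite divr_ge0 ?(ltW ab0)//= ler_pdivrMr// mul1r lerDr.
have xE : x - p = (a + b) *: ((1 - b / (a + b)) *: (F i).1 + b / (a + b) *: (F (ordS i)).1).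
  by rewrite xab; apply: planeP; rewrite !mxE; field; rewrite gt_eqF.
have abr : a + b = r.
  by rewrite -xr xE (aniso_scale R phi)// on_facet// mulr1.
exists i => //; exists (b / (a + b)); first by rewrite /= in_itv.
rewrite -[RHS](subrK p) xE abr.
by apply: planeP; rewrite !mxE; ring.
Qed.

End WulffPolygon.

(** * The elastic flow *)

(** Supplies the continuity of the derivatives that [elastic_flow] demands. *)
Lemma flow_field_continuous (R : realType) (n : nat) (a : 'I_n -> 'I_n -> R)
    (w rho : 'I_n -> R) (L : R -> 'I_n -> R) (t : R) :
  (forall i, 0 < L t i) -> (forall i, {for t, continuous (L^~ i)}) ->
  forall i, {for t, continuous (fun s => flow_field R n a w rho (L s) i)}.
Proof.
move=> L0 cL i; have ne j : L t j != 0 by rewrite gt_eqF.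
apply: cvgN; apply: cvgM.
  by apply: cvgM; [exact: cvg_cst|apply: cvgV => //; exact: cL].
rewrite /lin; elim: (index_enum _) => [|j r IH].
  rewrite big_nil (_ : (fun s : R => _) = (fun=> 0)); first exact: cvg_cst.
  by apply/funext => s; rewrite big_nil.
rewrite big_cons (_ : (fun s : R => _) = (fun s : R => a i j * grad R n w rho (L s) j
  + \sum_(k <- r) a i k * grad R n w rho (L s) k)); last first.
  by apply/funext => s; rewrite big_cons.
apply: cvgD => //; apply: cvgM; first exact: cvg_cst.
apply: cvgM; first exact: cvg_cst.
apply: cvgB; first exact: cvg_cst.
apply: cvgM; first exact: cvg_cst.
apply: cvgV; first by rewrite expf_neq0.
by apply: cvgM; exact: cL.
Qed.

Section ElasticFlow.
Variables (R : realType) (phi : plane R -> R) (alpha : R) (n : nat).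
Variables (G0 : 'I_n -> plane R) (F : 'I_n -> oseg R).
Hypotheses (phi_aniso : anisotropy phi) (alpha0 : 0 < alpha).
Hypotheses (G0_closed : closed_polygonal G0) (G0_adm : admissible phi G0 F).
Hypotheses (G0_convex : convex_curve G0) (G0_cw : clockwise G0).

Local Notation tau := (fun i => tangent (side G0 i)).
Local Notation N i := (normal (side G0 i)).

Let A := side_mx R n tau.
(** The dual anisotropy at [N i], written as a support number of the facet polygon so that the side
    matrix applies to it. *)
Let w i := dot (F i).1 (N i).
Let rho i := Num.sqrt alpha * len (F i).
Let x0 i := dot (G0 i) (N i).
Let L0 i := len (side G0 i).

Let len0 i : 0 < len (side G0 i).
Proof. by have [_ + _] := G0_closed. Qed.

Let i0 : 'I_n.
Proof. by have [n0 _ _] := G0_closed; exact: Ordinal n0. Defined.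

Let tau1 i : dot (tau i) (tau i) = 1.
Proof. exact: tangent_unit. Qed.

Let N1 i : dot (N i) (N i) = 1.
Proof. by rewrite -[RHS](tau1 i) /normal !coordE; ring. Qed.

Let theta_pi i : pi < theta G0 i.
Proof. by have [] := convex_clockwise_transition R n G0 G0_closed G0_convex G0_cw i. Qed.

Let trans1 i : transition G0 i = 1.
Proof. by have [] := convex_clockwise_transition R n G0 G0_closed G0_convex G0_cw i. Qed.

Let angles i : [/\ det2 (tau (ord_pred i)) (tau i) < 0,
  sin (theta G0 i) = det2 (tau (ord_pred i)) (tau i) &
  cos (theta G0 i) = - dot (tau (ord_pred i)) (tau i)].
Proof. exact: (clockwise_turn R n G0 G0_closed). Qed.

Let turn_ne0 i : det2 (tau (ord_pred i)) (tau i) != 0.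
Proof. by have [h _ _] := angles i; rewrite lt_eqF. Qed.

Let facet i : is_facet (unit_wulff phi) (F i).
Proof. by have [+ _ _] := G0_adm. Qed.

Let F_normal i : normal (F i) = N i.
Proof. by have [_ h _] := G0_adm; rewrite h. Qed.

Let F_tangent i : tangent (F i) = tau i.
Proof. exact: rot90_inj (F_normal i). Qed.

Let F_len i : 0 < len (F i).
Proof. by have [] := facet_ends R phi (F i) (facet i). Qed.

Let F_join i : (F i).2 = (F (ordS i)).1.
Proof.
have [_ _ cv] := G0_adm; have := cv (ordS i); rewrite ordSK => cvi.
apply: (facets_join R phi) => //; rewrite !F_tangent.
by have [] := angles (ordS i); rewrite ordSK.
Qed.

Let w_dual i : dual phi (N i) = w i.
Proof. by rewrite -F_normal (dual_facet R phi)// F_normal. Qed.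

Let w0 i : 0 < w i.
Proof. by rewrite /w -F_normal (dual_facet_gt0 R phi). Qed.

Let rho0 i : 0 < rho i.
Proof. by rewrite mulr_gt0// sqrtr_gt0. Qed.

Let A_sym i j : A i j = A j i.
Proof. exact: side_mx_sym. Qed.

Let support_lin (v : 'I_n -> plane R) (D : 'I_n -> R) :
  (forall i, v (ordS i) - v i = D i *: tau i) ->
  forall i, lin R n A (fun j => dot (v j) (N j)) i = D i.
Proof. exact: (lin_side_mx_support R n tau tau1 turn_ne0). Qed.

Let F_side i : (F (ordS i)).1 - (F i).1 = len (F i) *: tau i.
Proof. by rewrite -F_join len_tangent// F_tangent. Qed.

Let lin_w i : lin R n A w i = len (F i).
Proof. exact: (support_lin (fun i => (F i).1) (fun i => len (F i)) F_side). Qed.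

Let G0_side i : G0 (ordS i) - G0 i = L0 i *: tau i.
Proof. exact: (len_tangent R (side G0 i)). Qed.

(** The gradient is [w - alpha X]. By [lin_w] the part [w] yields the facet length of the first
    velocity term; the tridiagonal formula for the part [X] yields the bracket, with sin theta = s
    and cot theta = - k / s. *)
Let velocityE (v : 'I_n -> plane R) i : (forall j, 0 < len (side v j)) ->
  velocity phi alpha G0 F v i =
    flow_field R n A w rho (fun j => len (side v j)) i / w i.
Proof.
move=> v0; pose L j := len (side v j).
have L_ne j : L j != 0 by rewrite gt_eqF// v0.
pose X j := len (F j) ^+ 2 * w j / L j ^+ 2.
have gradE : grad R n w rho L = fun j => w j - alpha * X j.
  apply/funext => j; rewrite /grad /rho exprMn sqr_sqrtr ?ltW// /X.
  by field; rewrite L_ne.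
rewrite /flow_field -/L gradE linB lin_w.
have -> : lin R n A (fun j => alpha * X j) i = alpha * lin R n A X i.
  by rewrite /lin mulr_sumr; apply: eq_bigr => j _; ring.
rewrite lin_side_mx /velocity !trans1 !expr1n /cot -/(L _) -/(L _) -/(L _).
have [_ s1 c1] := angles i; have [_ s2 c2] := angles (ordS i).
rewrite s1 c1 s2 c2 /delta !w_dual ordSK /X.
have t1 := turn_ne0 i; have := turn_ne0 (ordS i); rewrite ordSK => t2.
have wi : w i != 0 by rewrite gt_eqF.
rewrite -/(L i) -/(L (ordS i)) -/(L (ord_pred i)).
move: (L_ne i) (L_ne (ordS i)) (L_ne (ord_pred i)).
move: (L i) (L (ordS i)) (L (ord_pred i)) => l1 l2 l3 l1_ne l2_ne l3_ne.
field.
by rewrite t1 t2 wi l1_ne l2_ne l3_ne.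
Qed.

Let heightE (v : 'I_n -> plane R) i : height G0 v i = dot (v i) (N i) - x0 i.
Proof. by rewrite /height /offset dotZl N1 mulr1 dotBl. Qed.

Let side_of_vec (S : oseg R) (l : R) i : 0 < l -> S.2 - S.1 = l *: tau i ->
  len S = l /\ tangent S = tau i.
Proof.
move=> l0 e; have lenS : len S = l.
  by rewrite /len e enormZ ?ltW// /enorm tau1 sqrtr1 mulr1.
by split=> //; rewrite /tangent lenS e scalerA mulVf ?scale1r// gt_eqF.
Qed.

(** The global heights are turned back into curves through the support numbers [x0 + h]; the
    positive lengths from [global_flow] make these curves parallel to [G0]. *)
Lemma global_elastic_flow : exists G, elastic_flow phi alpha G0 F +oo%E G.
Proof.
have [h [h0 hP]] := global_flow R n A w rho A_sym w0 rho0 L0 len0.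
have := fun t : R => side_mx_vertices R n tau tau1 turn_ne0 (fun i => x0 i + h t i).
move=> /choice[G GP].
have linG (t : R) i : lin R n A (fun j => x0 j + h t j) i = L0 i + lin R n A (h t) i.
  by rewrite linD (support_lin G0 L0 G0_side).
have sideG (t : R) i : 0 <= t ->
    len (side (G t) i) = L0 i + lin R n A (h t) i /\ tangent (side (G t) i) = tau i.
  move=> t0; have [hL _] := hP t t0; apply: side_of_vec; first exact: hL.
  by have [_] := GP t i; rewrite -/A linG.
have heightG i : (fun t : R => height G0 (G t) i) = h^~ i.
  by apply/funext => t; rewrite heightE; have [-> _] := GP t i; rewrite addrC addKr.
have dh (t : R) i : 0 <= t -> is_derive t 1 (h^~ i)
    (flow_field R n A w rho (fun j => L0 j + lin R n A (h t) j) i).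
  by move=> t0; have [_] := hP t t0; exact.
exists G; split => // [t t0 _ i|i /=].
  have [hL _] := hP t t0; have [l1 tt] := sideG t i t0.
  split; first by rewrite l1 hL.
    rewrite /parallel dot_rot90 (len_tangent R _ (len0 i)) len_tangent ?l1//.
    by rewrite tt /det2 !mxE; ring.
  by rewrite /normal tt.
rewrite heightG; split.
- apply: continuous_in_subspaceT => t; rewrite inE /= => -[t0 _].
  exact: is_derive_continuous (dh t i t0).
- by rewrite (congr1 (fun g => g 0) (heightG i)) h0.
move=> t t0 _; have [dt et] := dh t i (ltW t0).
have d1 s : 0 <= s -> derive1 (h^~ i) s =
    flow_field R n A w rho (fun j => L0 j + lin R n A (h s) j) i.
  by move=> s0; rewrite derive1E; have [_] := dh s i s0.
split; first exact: dt.
  suff : derive1 (h^~ i) r @[r --> t] --> derive1 (h^~ i) t by [].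
  rewrite (d1 t (ltW t0)).
  apply: cvg_trans (flow_field_continuous R n A w rho
    (fun s j => L0 j + lin R n A (h s) j) t _ _ i).
  - apply: near_eq_cvg; near=> s; rewrite d1//.
    by apply: ltW; near: s; exact: lt_nbhsr.
  - by have [] := hP t (ltW t0).
  - move=> j; apply: (is_derive_continuous R _ _
      (0 + lin R n A (flow_field R n A w rho (fun j => L0 j + lin R n A (h t) j)) j)).
    apply: is_deriveD (is_derive_cst (L0 j) t 1) (is_derive_lin R n A h _ t j _).
    by move=> k; exact: dh (ltW t0).
rewrite w_dual d1 ?ltW// velocityE; last first.
  move=> j; have [-> _] := sideG t j (ltW t0); by have [] := hP t (ltW t0).
congr (flow_field _ _ _ _ _ _ _ / _); apply/funext => j.
by have [-> _] := sideG t j (ltW t0).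
Unshelve. all: by end_near. Qed.

Lemma elastic_flow_cvg G : elastic_flow phi alpha G0 F +oo%E G ->
  exists p : plane R, kuratowski_cvg (fun t => trace (G t))
    (boundary (wulff phi (Num.sqrt alpha) p)).
Proof.
move=> [_ par flow].
pose h (t : R) i := height G0 (G t) i.
pose L (t : R) i := L0 i + lin R n A (h t) i.
have sideG (t : R) i : 0 <= t -> G t (ordS i) - G t i = len (side (G t) i) *: tau i.
  move=> t0; have [l _ nG] := par t t0 (ltry t) i.
  by rewrite -(rot90_inj R _ _ nG); exact: (len_tangent R (side (G t) i)).
have bE (t : R) i : dot (G t i) (N i) = x0 i + h t i.
  by rewrite /h heightE addrC subrK.
have LE (t : R) : 0 <= t -> L t = fun i => len (side (G t) i).
  move=> t0; apply/funext => i.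
  rewrite -(support_lin (G t) _ (fun i => sideG t i t0)) /L.
  rewrite -(support_lin G0 L0 G0_side) -linD; congr (lin _ _ _ _ _).
  by apply/funext => j; rewrite bE.
have L_gt0 (t : R) i : 0 <= t -> 0 < L t i.
  by move=> t0; rewrite LE//; have [] := par t t0 (ltry t) i.
have dh (t : R) i : 0 < t -> is_derive t 1 (h^~ i) (flow_field R n A w rho (L t) i).
  move=> t0; have [_ _ /(_ t t0 (ltry t))[d _ e]] := flow i.
  apply: DeriveDef; first exact: d.
  rewrite -derive1E; move: e; rewrite w_dual velocityE; last first.
    by move=> j; have [] := par t (ltW t0) (ltry t) j.
  rewrite -LE ?ltW//; apply: divIf.
  by rewrite gt_eqF.
have dL (t : R) i : 0 < t ->
    is_derive t 1 (L^~ i) (lin R n A (flow_field R n A w rho (L t)) i).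
  move=> t0; rewrite -[lin _ _ _ _ _]add0r.
  apply: is_deriveD (is_derive_cst (L0 i) t 1) (is_derive_lin R n A h _ t i _).
  by move=> k; exact: dh.
have [K K0 spread] := vertex_spread R n tau tau1 i0.
(* The difference of the curve and the scaled facet polygon is a closed polygon with signed sides
   [L - rho]; its support numbers relative to vertex [i0] serve as [y]. *)
pose u (t : R) i := G t i - Num.sqrt alpha *: (F i).1.
have uD (t : R) : 0 <= t -> forall i, u t (ordS i) - u t i = (L t i - rho i) *: tau i.
  move=> t0 i; rewrite LE// /u /rho.
  have -> : G t (ordS i) - Num.sqrt alpha *: (F (ordS i)).1
      - (G t i - Num.sqrt alpha *: (F i).1) =
      (G t (ordS i) - G t i) - Num.sqrt alpha *: ((F (ordS i)).1 - (F i).1).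
    by apply: planeP; rewrite !mxE; ring.
  by rewrite sideG// F_side; apply: planeP; rewrite !mxE; ring.
have pos1 (t : R) : 1 <= t -> 0 < t by exact: lt_le_trans.
have [hl Ll] : (forall i, exists l : R, h t i @[t --> +oo] --> l) /\
    (forall i, L t i @[t --> +oo] --> rho i).
  apply: (flow_converges R n A w rho A_sym w0 rho0 L h
    (fun t i => dot (u t i - u t i0) (N i)) K K0).
  - by move=> t t1 i; apply: L_gt0; exact: ltW (pos1 t t1).
  - by move=> t t1 i; apply: dh; exact: pos1.
  - by move=> t t1 i; apply: dL; exact: pos1.
  - move=> t t1 i.
    apply: (support_lin (fun i => u t i - u t i0) (fun i => L t i - rho i)) => j.
    rewrite -uD; last exact: ltW (pos1 t t1).
    by apply: planeP; rewrite !mxE; ring.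
  - by move=> t t1 i; apply: spread; apply: uD; exact: ltW (pos1 t t1).
have [l lP] := choice hl.
pose s i := det2 (tau (ord_pred i)) (tau i).
pose k i := dot (tau (ord_pred i)) (tau i).
(* The intersection of two consecutive support lines depends linearly on their support numbers, so
   converging heights give converging vertices. *)
pose vertex (b : 'I_n -> R) i : plane R :=
  ((b (ord_pred i) - k i * b i) / s i) *: tau i + b i *: N i.
have GE (t : R) i : 0 <= t -> G t i = vertex (fun j => x0 j + h t j) i.
  move=> t0; rewrite /vertex -!bE {1}(unit_decomp R (tau i) (G t i) (tau1 i)).
  congr (_ *: _ + _).
  have e0 := sideG t (ord_pred i) t0; rewrite ord_predK in e0.
  have -> : dot (G t (ord_pred i)) (N (ord_pred i)) = dot (G t i) (N (ord_pred i)).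
    apply/eqP; rewrite eq_sym -subr_eq0 -dotBl e0 dotZl /normal dot_rot90r /det2.
    by apply/eqP; ring.
  apply: (mulIf (turn_ne0 i)); rewrite divfK ?turn_ne0//.
  rewrite /k /normal !dot_rot90r -[det2 _ (G t i) in RHS]mulr1 -(tau1 i).
  by rewrite !dotE /det2; ring.
pose b i := x0 i + l i.
have GV i c : G t i 0 c @[t --> +oo] --> vertex b i 0 c.
  have bl j : (x0 j + h t j) @[t --> +oo] --> b j.
    by apply: cvgD; [exact: cvg_cst|exact: lP].
  have : vertex (fun j => x0 j + h t j) i 0 c @[t --> +oo] --> vertex b i 0 c.
    have vE (x : 'I_n -> R) : vertex x i 0 c =
        (x (ord_pred i) - k i * x i) / s i * tau i 0 c + x i * N i 0 c.
      by rewrite /vertex !mxE.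
    rewrite vE (_ : (fun t : R => _) = (fun t : R =>
      ((x0 (ord_pred i) + h t (ord_pred i)) - k i * (x0 i + h t i)) / s i * tau i 0 c +
      (x0 i + h t i) * N i 0 c)); last by apply/funext => t; rewrite vE.
    apply: cvgD; last by apply: cvgMl; exact: bl.
    apply: cvgMl; apply: cvgMl; apply: cvgB; first exact: bl.
    by apply: cvgMr; exact: bl.
  apply: cvg_trans; apply: near_eq_cvg; near=> t.
  have t0 : 0 <= t by [].
  by rewrite (GE t i t0).
have V_side i : vertex b (ordS i) - vertex b i = rho i *: tau i.
  have coord c : (vertex b (ordS i) - vertex b i) 0 c = (rho i *: tau i) 0 c.
    have -> : (vertex b (ordS i) - vertex b i) 0 c =
        vertex b (ordS i) 0 c - vertex b i 0 c by rewrite !mxE.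
    have -> : (rho i *: tau i) 0 c = rho i * tau i 0 c by rewrite !mxE.
    have h1 : (G t (ordS i) 0 c - G t i 0 c) @[t --> +oo] -->
        vertex b (ordS i) 0 c - vertex b i 0 c by apply: cvgB; exact: GV.
    have h2 : (L t i * tau i 0 c) @[t --> +oo] --> rho i * tau i 0 c.
      by apply: cvgMl; exact: Ll.
    rewrite -(cvg_lim (@Rhausdorff R) h1); apply: (cvg_lim (@Rhausdorff R)).
    apply: cvg_trans h2; apply: near_eq_cvg; near=> t.
    have t0 : 0 <= t by [].
    have := congr1 (fun x : plane R => x 0 c) (sideG t i t0).
    by rewrite LE// !mxE => ->.
  by apply: planeP; exact: coord.
(* The translation is fixed by matching one vertex; equal sides propagate it around the cycle. *)
pose p := vertex b i0 - Num.sqrt alpha *: (F i0).1.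
have VE : vertex b = fun i => p + Num.sqrt alpha *: (F i).1.
  apply/funext; apply: (ordS_ind n (fun i => vertex b i = p + Num.sqrt alpha *: (F i).1) i0).
    by rewrite /p subrK.
  move=> i e; rewrite -[LHS](subrK (vertex b i)) V_side e.
  rewrite -[(F (ordS i)).1](subrK (F i).1) F_side /rho.
  by apply: planeP; rewrite !mxE; ring.
exists p; rewrite -(trace_facets R phi n F phi_aniso facet F_join i0) ?sqrtr_gt0// -VE.
exact: trace_kuratowski.
Unshelve. all: by end_near. Qed.

End ElasticFlow.

Theorem corollary7p2 (R : realType) (phi : plane R -> R) (alpha : R)
    (n : nat) (G0 : 'I_n -> plane R) (F : 'I_n -> oseg R)
    (T : \bar R) (G : R -> 'I_n -> plane R) :
  anisotropy phi -> crystalline phi ->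
  0 < alpha ->
  closed_polygonal G0 -> admissible phi G0 F ->
  convex_curve G0 -> clockwise G0 ->
  maximal_elastic_flow phi alpha G0 F T G ->
  T = +oo%E /\
  exists p : plane R,
    kuratowski_cvg (fun t => trace (G t))
      (boundary (wulff phi (Num.sqrt alpha) p)).
Proof.
move=> an _ a0 cl adm cv cw [fl maxT].
have T_oo : T = +oo%E.
  (* The global flow competes in the maximality of [T] and forces it to be infinite; the convergence
     is then proved for [G] itself. *)
  have [G' flG'] := global_elastic_flow R phi alpha n G0 F an a0 cl adm cv cw.
  by apply/eqP; rewrite -leye_eq; exact: maxT flG'.
split=> //; rewrite T_oo in fl.
exact: (elastic_flow_cvg R phi alpha n G0 F an a0 cl adm cv cw G fl).
Qed.
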